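(* Let $f$ be a monic complex polynomial of degree $n \ge 2$, $1 \le p \le \infty$ and $1/p + 1/q = 1$. Define the real function $$\phi(x) = \frac{a^2 x^3}{(1 - m x + b x^2)(1 - (a + 2) x + x^2)} \left(1 + \frac{1}{n-1} \cdot \frac{a(x - x^2)}{1 - m x + b x^2} \right)^{n - 1},$$ where $a = (n - 1)^{1/q}$, $b = 2^{1/q}$ and $m=a+b+1$. Suppose that $z^0$ is an initial point in $\mathbb{C}^n$ with distinct components satisfying $$E(z^0) < \frac{2}{m + \sqrt{m^2 - 4b}} \quad\text{and}\quad \phi(E(z^0)) \le 1.$$ Define also $\psi(x) = \dfrac{1 - m x + b x^2}{1 - (a+1) x}$ and $\mu(x) = \dfrac{1 - x}{1 - (a+1) x}$. Then the following statements hold true. 1. Nourein's iterative sequence $z^{k+1} = G(z^k)$, $k=0,1,2,\ldots$, is well-defined and convergent to a root-vector $\xi$ of $f$. Moreover, if $\phi(E(z^0)) < 1$, then the order of convergence is four. 2. For each $k \ge 1$ we have the a priori error estimate $$\left\| z^k - \xi \right\|_p \le \mu\left(E(z^0) \lambda^{(4^k - 1)/3}\right) \, \frac{\theta^k \lambda^{(4^k - 1)/3}}{1 - \theta \lambda^{4^k}} \left\| W(z^0) \right\|_p,$$ where $\lambda = \phi(E(z^0))$ and $\theta = \psi(E(z^0))$. 3. For all $k \ge 0$ we have the a posteriori error estimate $$\left\| z^k - \xi \right\|_p \le \frac{\mu(E(z^k))}{1 - \theta_k \lambda_k} \left\| W(z^k) \right\|_p,$$ where $\lambda_k = \phi(E(z^k))$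 and $\theta_k = \psi(E(z^k))$.
   Context: $\|z\|_p = \left(\sum_{i=1}^n |z_i|^p\right)^{1/p}$ is the usual $p$-norm on $\mathbb{C}^n$ (maximum norm for $p=\infty$), and $1/\infty = 0$. A point $\xi\in\mathbb{C}^n$ is a root-vector of $f$ if its components are exactly the zeros of $f$ with their multiplicities. For a point $z=(z_1,\ldots,z_n) \in \mathbb{C}^n$ with distinct components, set, for $i=1,\ldots,n$, $$W_i(z) = \frac{f(z_i)}{\prod_{j \ne i}(z_i - z_j)}, \qquad W(z) = (W_1(z),\ldots,W_n(z)), \qquad d_i(z) = \min\{|z_i - z_j| : j \ne i\},$$ $$\frac{W(z)}{d(z)} = \left(\frac{W_1(z)}{d_1(z)}, \ldots, \frac{W_n(z)}{d_n(z)}\right), \qquad E(z) = \left\| \frac{W(z)}{d(z)} \right\|_p .$$ Nourein's iteration is $z^{k+1} = G(z^k)$, where $G(z) = (G_1(z),\ldots,G_n(z))$ with $$G_i(z) = z_i - \frac{W_i(z)}{1 + \sum_{j \ne i} W_j(z)/(z_i - z_j - W_i(z))}.$$ *)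

(* Defs.v *)
From mathcomp Require Import all_boot all_order all_algebra.
From mathcomp Require Import all_classical all_reals all_analysis.
From mathcomp Require Import complex.

Set Implicit Arguments.
Unset Strict Implicit.
Unset Printing Implicit Defensive.

Import Order.TTheory GRing.Theory Num.Theory.
Import numFieldNormedType.Exports.

Local Open Scope ring_scope.
Local Open Scope complex_scope.

(* The R-valued modulus; [`|x|] itself lives in R[i]. *)
Definition modulus (R : realType) (x : R[i]) : R := ComplexField.Normc.normc x.

(* Only meaningful for 1 <= p <= +oo; the value at -oo is a dummy. *)
Definition pnorm (R : realType) (n : nat) (p : \bar R) (z : 'rV[R[i]]_n) : R :=
  match p with
  | EFin r => (\sum_(i < n) modulus (z 0 i) `^ r) `^ r^-1
  | +oo%E => \big[Num.max/0]_(i < n) modulus (z 0 i)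
  | -oo%E => 0
  end.

Definition distinct_components (R : realType) (n : nat) (z : 'rV[R[i]]_n) : Prop :=
  injective (fun i : 'I_n => z 0 i).

Definition root_vector (R : realType) (n : nat) (f : {poly R[i]})
    (xi : 'rV[R[i]]_n) : Prop :=
  forall x : R[i], mup x f = #|[pred i : 'I_n | xi 0 i == x]|.

Definition weierstrass (R : realType) (n : nat) (f : {poly R[i]})
    (z : 'rV[R[i]]_n) : 'rV[R[i]]_n :=
  \row_(i < n) (f.[z 0 i] / \prod_(j < n | j != i) (z 0 i - z 0 j)).

(* The neutral element +oo is never attained for n >= 2, where the index set is
   nonempty, so [fine] returns the actual minimum. *)
Definition separation (R : realType) (n : nat) (z : 'rV[R[i]]_n) (i : 'I_n) : R :=
  fine (\big[Order.min/+oo%E]_(j < n | j != i) (modulus (z 0 i - z 0 j))%:E).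

Definition initialE (R : realType) (n : nat) (p : \bar R) (f : {poly R[i]})
    (z : 'rV[R[i]]_n) : R :=
  pnorm p (\row_(i < n) (weierstrass f z 0 i / (separation z i)%:C)).

Definition nourein_denom (R : realType) (n : nat) (f : {poly R[i]})
    (z : 'rV[R[i]]_n) (i : 'I_n) : R[i] :=
  1 + \sum_(j < n | j != i)
        weierstrass f z 0 j / (z 0 i - z 0 j - weierstrass f z 0 i).

Definition nourein (R : realType) (n : nat) (f : {poly R[i]})
    (z : 'rV[R[i]]_n) : 'rV[R[i]]_n :=
  \row_(i < n) (z 0 i - weierstrass f z 0 i / nourein_denom f z i).

(* The natural domain of [nourein]: all the divisors in its formula are nonzero
   (division in R[i] is total, with x / 0 = 0). *)
Definition nourein_domain (R : realType) (n : nat) (f : {poly R[i]})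
    (z : 'rV[R[i]]_n) : Prop :=
  [/\ distinct_components z,
      forall i j : 'I_n, j != i -> z 0 i - z 0 j - weierstrass f z 0 i != 0
    & forall i : 'I_n, nourein_denom f z i != 0].

Definition nourein_seq (R : realType) (n : nat) (f : {poly R[i]})
    (z0 : 'rV[R[i]]_n) (k : nat) : 'rV[R[i]]_n :=
  iter k (nourein f) z0.

Definition converges_to (R : realType) (n : nat) (p : \bar R)
    (z : nat -> 'rV[R[i]]_n) (xi : 'rV[R[i]]_n) : Prop :=
  ((fun k => pnorm p (z k - xi)) @ \oo --> (0 : R))%classic.

(* (Q-)order of convergence r, in the usual sense of "at least r": e.g. if the
   starting point is already a root-vector, all the errors vanish. *)
Definition convergence_order (R : realType) (n : nat) (p : \bar R)
    (z : nat -> 'rV[R[i]]_n) (xi : 'rV[R[i]]_n) (r : nat) : Prop :=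
  converges_to p z xi /\
  exists C : R, \forall k \near \oo%classic,
    pnorm p (z k.+1 - xi) <= C * pnorm p (z k - xi) ^+ r.

(* 1/q is computed in \bar R, where (+oo)^-1 = 0. *)
Definition coef_a (R : realType) (n : nat) (q : \bar R) : R :=
  (n - 1)%:R `^ fine (q^-1)%E.

Definition coef_b (R : realType) (q : \bar R) : R := 2 `^ fine (q^-1)%E.

Definition coef_m (R : realType) (n : nat) (q : \bar R) : R :=
  coef_a n q + coef_b q + 1.

Definition phi (R : realType) (n : nat) (q : \bar R) (x : R) : R :=
  let a := coef_a n q in let b := coef_b q in let m := coef_m n q in
  a ^+ 2 * x ^+ 3 /
    ((1 - m * x + b * x ^+ 2) * (1 - (a + 2) * x + x ^+ 2)) *
  (1 + 1 / (n - 1)%:R * (a * (x - x ^+ 2) / (1 - m * x + b * x ^+ 2)))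
    ^+ (n - 1).

Definition psi (R : realType) (n : nat) (q : \bar R) (x : R) : R :=
  (1 - coef_m n q * x + coef_b q * x ^+ 2) / (1 - (coef_a n q + 1) * x).

Definition mu (R : realType) (n : nat) (q : \bar R) (x : R) : R :=
  (1 - x) / (1 - (coef_a n q + 1) * x).

(* Main.v *)
Require Import Defs.
From mathcomp Require Import all_boot all_order all_algebra.
From mathcomp Require Import all_classical all_reals all_analysis.
From mathcomp Require Import complex.
From mathcomp Require Import ring lra.

(** For a point z with corrections W = W(z), put E = E(z) and zh = G(z). One step of
    the iteration obeys three componentwise estimates:
      |zh_i - z_i| <= mu(E) |W_i|                 ([nourein_increment_le]),
      |zh_i - zh_j| >= psi(E) |z_i - z_j|         ([nourein_distance_ge]),
      |W_i(zh)| <= psi(E) phi(E) |W_i|            ([nourein_weierstrass_le]).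
    The third one is the heart. Lagrange interpolation at the components of z gives
      f(x) = prod_j (x - z_j) + sum_j W_j prod_(k <> j) (x - z_k),
    and at x = zh_i the definition of G makes the terms of low order cancel exactly
    ([horner_nourein]), so W_i(zh) is W_i times a quantity of order E^3. The p-norm
    enters through its monotonicity and through Hölder's inequality: the sum of the
    moduli of all entries but one is at most a times the norm, that of two entries
    at most b times the norm ([sum_modulus_le_pnorm]); this is where a, b and
    m = a + b + 1 come from.

    The last two estimates give E(zh) <= phi(E) E ([nourein_E_le]). As phi and
    psi phi are x^3 times nondecreasing functions, they satisfy g(t x) <= t^3 g(x)
    for t <= 1 ([phi_scale], [psi_phi_scale]). By induction
      E(z^k) <= lam^((4^k - 1)/3) E(z^0),
      |W_i(z^k)| <= theta^k lam^((4^k - 1)/3) |W_i(z^0)|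
    ([nourein_seq_E_le], [nourein_seq_W_le]). Moreover psi phi < 1, even if phi = 1,
    so the increments are dominated by a geometric series with ratio theta lam. It
    follows that the iterates converge to some xi, and summing the series from z^k
    on is the a posteriori estimate; inserting the previous bounds in it gives the
    a priori one. Letting k tend to infinity in the interpolation formula yields
    f(x) = prod_j (x - xi_j), so xi is a root-vector ([limit_factorization]).

    If lam < 1, the same series shows that the components stay apart by a fixed
    fraction of their initial distances ([nourein_seq_distance_ge]). Then E(z^k) is
    bounded by a multiple of the norm of W(z^k), the step estimates make the error
    at k + 1 at most a multiple of the fourth power of the norm of W(z^k), and W is
    bounded by the error through the factorisation of f ([weierstrass_le_error]),
    which is convergence of order four ([nourein_order4]). *)

Set Implicit Arguments.
Unset Strict Implicit.
Unset Printing Implicit Defensive.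

Import Order.TTheory GRing.Theory Num.Theory.
Import numFieldNormedType.Exports.

Local Open Scope ring_scope.
Local Open Scope complex_scope.

(** * The coefficients and the gauge functions *)

Lemma coef_a_ge1 (R : realType) (n : nat) (q : \bar R) : (2 <= n)%N ->
  0 <= fine (q^-1)%E -> 1 <= coef_a n q.
Proof.
move=> n2 q0; have n1 : 1 <= (n - 1)%:R :> R by rewrite ler1n subn_gt0.
by have := ler_powR n1 q0; rewrite powRr0.
Qed.

Lemma coef_b_ge1 (R : realType) (q : \bar R) :
  0 <= fine (q^-1)%E -> 1 <= coef_b q.
Proof. by move=> /(ler_powR (ler1n R 2)); rewrite powRr0. Qed.

Lemma coef_b_le2 (R : realType) (q : \bar R) :
  fine (q^-1)%E <= 1 -> coef_b q <= 2.
Proof. by move=> /(ler_powR (ler1n R 2)); rewrite powRr1. Qed.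

Section Gauges.
Variables (R : realType) (n : nat) (q : \bar R).
Hypothesis coefs : [/\ 1 <= coef_a n q, 1 <= coef_b q & coef_b q <= 2].

Local Notation a := (coef_a n q).
Local Notation b := (coef_b q).
Local Notation m := (coef_m n q).
Local Notation phi := (Defs.phi n q).
Local Notation psi := (Defs.psi n q).
Local Notation mu := (Defs.mu n q).

Let a_ge0 : 0 <= coef_a n q.
Proof. by have [a1 _ _] := coefs; exact: le_trans ler01 a1. Qed.

Let b_ge0 : 0 <= coef_b q.
Proof. by have [_ b1 _] := coefs; exact: le_trans ler01 b1. Qed.

Definition gauge_radius : R := 2 / (m + Num.sqrt (m ^+ 2 - 4 * b)).

(** The proof rests on the factorisation 1 - m x + b x^2 = (1 - b x)(1 - x) - a x,
    whose smallest root is [gauge_radius]. Apart from b x < 1, the conclusions are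
    the positivity of the denominators of [phi], [psi] and [mu]. *)
Lemma below_radius (x : R) : 0 <= x -> x < gauge_radius ->
  [/\ 0 < 1 - m * x + b * x ^+ 2, b * x < 1, 0 < 1 - (a + 1) * x
    & 0 < 1 - (a + 2) * x + x ^+ 2].
Proof.
have [a1 b1 b2] := coefs.
move=> x0; rewrite /gauge_radius.
have mE : m = a + b + 1 by [].
set D := m ^+ 2 - 4 * b; set s := Num.sqrt D.
have D0 : 0 <= D.
  rewrite /D mE (_ : _ - _ = (a + 1 - b) ^+ 2 + 4 * (a * b)); last by ring.
  by rewrite addr_ge0 ?sqr_ge0// mulr_ge0// mulr_ge0.
have s0 : 0 <= s by apply: sqrtr_ge0.
have s2 : s ^+ 2 = D by rewrite sqr_sqrtr.
have m3 : 3 <= m by rewrite mE; lra.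
rewrite ltr_pdivlMr; last by lra.
move=> xms.
have mx2 : m * x < 2 by nra.
have xs : x * s < 2 - m * x by lra.
have D1 : 0 < 1 - m * x + b * x ^+ 2.
  have : (x * s) ^+ 2 < (2 - m * x) ^+ 2.
    by rewrite ltr_pXn2r ?nnegrE ?mulr_ge0 ?subr_ge0 ?(ltW mx2).
  by rewrite exprMn s2 /D => H; lra.
have bx : b * x < 1.
  by move: mx2; rewrite mE => mx2; have : (b - 2) * x <= 0; nra.
have fact : 1 - m * x + b * x ^+ 2 = (1 - b * x) * (1 - x) - a * x.
  by rewrite mE; ring.
have x1 : x < 1 by nra.
have ax : a * x < (1 - b * x) * (1 - x) by rewrite -subr_gt0 -fact.
have bxx : (1 - b * x) * (1 - x) <= 1 - x.
  by apply: ler_piMl; [rewrite subr_ge0 ltW|rewrite gerBl mulr_ge0].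
split => //; first by lra.
have : (1 - b * x) * (1 - x) <= (1 - x) * (1 - x).
  by apply: ler_wpM2r; nra.
by nra.
Qed.

Lemma below_radius_half (x : R) : 0 <= x -> x < gauge_radius -> x < 2^-1.
Proof. have [a1 b1 b2] := coefs; by move=> x0 /(below_radius x0) [_ _ H _]; nra. Qed.

Lemma mu_ge1 (x : R) : 0 <= x -> x < gauge_radius -> 1 <= mu x.
Proof.
have [a1 b1 b2] := coefs.
move=> x0 /(below_radius x0) [_ _ H _].
by rewrite /Defs.mu ler_pdivlMr// mul1r; nra.
Qed.

Lemma mu_mono (x y : R) : 0 <= y -> y <= x -> x < gauge_radius -> mu y <= mu x.
Proof.
have [a1 b1 b2] := coefs.
move=> y0 yx xr; have x0 := le_trans y0 yx; have yr := le_lt_trans yx xr.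
have [_ _ Hx _] := below_radius x0 xr; have [_ _ Hy _] := below_radius y0 yr.
rewrite /Defs.mu ler_pdivrMr// mulrAC ler_pdivlMr//; nra.
Qed.

(** Since 1 - b x mu(x) bounds the relative shrinking of the distances between
    components in one iteration, this identity is where the shape of [psi] comes
    from. *)
Lemma psiE (x : R) : 0 <= x -> x < gauge_radius -> psi x = 1 - b * (x * mu x).
Proof.
move=> x0 /(below_radius x0) [_ _ H _].
rewrite /Defs.psi /Defs.mu /coef_m; field; exact: lt0r_neq0.
Qed.

Lemma psi_gt0 (x : R) : 0 <= x -> x < gauge_radius -> 0 < psi x.
Proof.
by move=> x0 /(below_radius x0) [H1 _ H _]; rewrite /Defs.psi divr_gt0.
Qed.

Lemma psi_lt1 (x : R) : 0 < x -> x < gauge_radius -> psi x < 1.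
Proof.
have [a1 b1 b2] := coefs.
move=> x0 xr; rewrite psiE ?ltW//; have := mu_ge1 (ltW x0) xr => mu1.
rewrite gtrBl mulr_gt0//; first by rewrite (lt_le_trans ltr01).
by rewrite mulr_gt0// (lt_le_trans ltr01).
Qed.

Let growth (x : R) : R :=
  (1 + 1 / (n - 1)%:R * (a * (x - x ^+ 2) / (1 - m * x + b * x ^+ 2)))
    ^+ (n - 1).

Let growth_mono (x y : R) : 0 <= y -> y <= x -> x < gauge_radius ->
  1 <= growth y <= growth x.
Proof.
have [a1 b1 b2] := coefs.
move=> y0 yx xr; have x0 := le_trans y0 yx; have yr := le_lt_trans yx xr.
have [Hx bx _ _] := below_radius x0 xr; have [Hy _ _ _] := below_radius y0 yr.
have xh := below_radius_half x0 xr; have yh := below_radius_half y0 yr.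
have n0 : 0 <= 1 / (n - 1)%:R :> R by rewrite mul1r invr_ge0 ler0n.
have g0 : 0 <= a * (y - y ^+ 2) / (1 - m * y + b * y ^+ 2).
  by apply: divr_ge0; [apply: mulr_ge0; nra|exact: ltW].
have gm : a * (y - y ^+ 2) / (1 - m * y + b * y ^+ 2) <=
          a * (x - x ^+ 2) / (1 - m * x + b * x ^+ 2).
  have inv_le : (1 - m * y + b * y ^+ 2)^-1 <= (1 - m * x + b * x ^+ 2)^-1.
    rewrite lef_pV2 ?posrE//.
    rewrite -subr_ge0 (_ : _ - _ = (x - y) * (m - b * x - b * y)); last by ring.
    apply: mulr_ge0; first by rewrite subr_ge0.
    have by1 : b * y <= b * x by apply: ler_wpM2l => //; lra.
    by rewrite /coef_m; lra.
  apply: ler_pM => //; [by apply: mulr_ge0; nra|by rewrite invr_ge0 ltW|].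
  by apply: ler_wpM2l; nra.
have H0 : 0 <= 1 / (n - 1)%:R * (a * (y - y ^+ 2) / (1 - m * y + b * y ^+ 2)).
  exact: mulr_ge0.
rewrite /growth; apply/andP; split; first by rewrite exprn_ege1// lerDl.
have H1 := ler_wpM2l n0 gm.
apply: lerXn2r; rewrite ?nnegrE ?lerD2l//; rewrite addr_ge0//.
exact: le_trans H0 H1.
Qed.

(** The common mechanism of [phi_scale] and [psi_phi_scale]: a function which is
    x^3 times a nondecreasing one is multiplied by at most t^3 when its argument
    is multiplied by t <= 1. *)
Let cubic_scale (g : R -> R) (t x y : R) :
  (forall u, 0 <= u -> u <= x -> 0 < g u) ->
  (forall u, 0 <= u -> u <= x -> g x <= g u) ->
  0 <= t <= 1 -> 0 <= y -> y <= t * x -> 0 <= x -> x < gauge_radius ->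
  a ^+ 2 * y ^+ 3 / g y * growth y <=
  t ^+ 3 * (a ^+ 2 * x ^+ 3 / g x * growth x).
Proof.
move=> gpos gdec /andP[t0 t1] y0 ytx x0 xr.
have yx : y <= x by apply: le_trans ytx _; exact: ler_piMl.
have /andP[G1 Gle] := growth_mono y0 yx xr.
have G0 := le_trans ler01 G1.
have c0 : 0 <= a ^+ 2 * y ^+ 3 by rewrite mulr_ge0 ?exprn_ge0.
have c1 : a ^+ 2 * y ^+ 3 <= t ^+ 3 * (a ^+ 2 * x ^+ 3).
  rewrite [leRHS]mulrCA -exprMn ler_wpM2l ?exprn_ge0//.
  by apply: lerXn2r; rewrite ?nnegrE// mulr_ge0.
rewrite [X in _ <= X]mulrA [X in _ <= X * _]mulrA.
have gy := gpos _ y0 yx; have gx := gpos _ x0 (lexx x).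
apply: ler_pM => //; first by rewrite mulr_ge0// invr_ge0 ltW.
by apply: ler_pM => //; rewrite ?invr_ge0 ?(ltW gy)// lef_pV2 ?posrE ?gdec.
Qed.

(** The source of the fourth order: if E(zh) <= phi(E) E, then taking t = phi(E)
    gives phi(E(zh)) <= phi(E)^4. *)
Lemma phi_scale (t x y : R) : 0 <= t <= 1 -> 0 <= y -> y <= t * x ->
  0 <= x -> x < gauge_radius -> phi y <= t ^+ 3 * phi x.
Proof.
have [a1 b1 b2] := coefs.
move=> t01 y0 ytx x0 xr.
apply: (@cubic_scale (fun x => (1 - m * x + b * x ^+ 2) *
                               (1 - (a + 2) * x + x ^+ 2))) => // {y0 ytx} y y0 yx;
  have yr := le_lt_trans yx xr.
  by have [H1 _ _ H2] := below_radius y0 yr; rewrite mulr_gt0.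
have [Hx bx _ H'x] := below_radius x0 xr.
have xh := below_radius_half x0 xr; have yh := below_radius_half y0 yr.
apply: ler_pM; try exact: ltW.
  rewrite -subr_ge0 (_ : _ - _ = (x - y) * (m - b * x - b * y)); last by ring.
  apply: mulr_ge0; first by rewrite subr_ge0.
  have by1 : b * y <= b * x by apply: ler_wpM2l => //; lra.
  by rewrite /coef_m; lra.
by nra.
Qed.

Lemma psi_phiE (x : R) : 0 <= x -> x < gauge_radius -> psi x * phi x =
  a ^+ 2 * x ^+ 3 / ((1 - (a + 1) * x) * (1 - (a + 2) * x + x ^+ 2)) *
  (1 + 1 / (n - 1)%:R * (a * (x - x ^+ 2) / (1 - m * x + b * x ^+ 2)))
    ^+ (n - 1).
Proof.
move=> x0 xr; have [H1 _ H2 H3] := below_radius x0 xr.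
rewrite /Defs.psi /Defs.phi mulrA; congr (_ * _).
by field; rewrite !lt0r_neq0.
Qed.

Lemma psi_phi_scale (t x y : R) : 0 <= t <= 1 -> 0 <= y -> y <= t * x ->
  0 <= x -> x < gauge_radius -> psi y * phi y <= t ^+ 3 * (psi x * phi x).
Proof.
move=> t01 y0 ytx x0 xr; have /andP[t0 t1] := t01.
have yx : y <= x by apply: le_trans ytx _; exact: ler_piMl.
have yr := le_lt_trans yx xr.
rewrite !psi_phiE//.
apply: (@cubic_scale (fun x => (1 - (a + 1) * x) *
                               (1 - (a + 2) * x + x ^+ 2))) => // {yr y0 ytx yx} y y0 yx;
  have yr := le_lt_trans yx xr.
  by have [_ _ H1 H2] := below_radius y0 yr; rewrite mulr_gt0.
have [_ _ Hx H'x] := below_radius x0 xr.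
have xh := below_radius_half x0 xr; have yh := below_radius_half y0 yr.
have ayx : a * y <= a * x by rewrite ler_wpM2l.
apply: ler_pM; try exact: ltW; last first.
  have : 0 <= (x - y) * (2 - x - y) by apply: mulr_ge0; lra.
  by nra.
by rewrite lerB ?ler_wpM2l// addr_ge0.
Qed.

Lemma phi_ge0 (x : R) : 0 <= x -> x < gauge_radius -> 0 <= phi x.
Proof.
move=> x0 xr; have [H1 _ _ H2] := below_radius x0 xr.
have /andP[G1 _] := growth_mono x0 (lexx x) xr.
apply: mulr_ge0; last exact: le_trans ler01 G1.
apply: divr_ge0; last by rewrite ltW// mulr_gt0.
by rewrite mulr_ge0 ?exprn_ge0.
Qed.

(** This keeps the ratio of the geometric series of the increments below 1 even in
    the limit case phi x = 1, where [phi] alone would not. *)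
Lemma psi_phi_lt1 (x : R) : 0 <= x -> x < gauge_radius -> phi x <= 1 ->
  psi x * phi x < 1.
Proof.
move=> x0 xr phi1; have ps0 := psi_gt0 x0 xr; have p0 := phi_ge0 x0 xr.
move: x0; rewrite le_eqVlt => /predU1P[x0|x0].
  by rewrite /Defs.phi -x0 expr0n /= mulr0 !mul0r mulr0.
have := psi_lt1 x0 xr => ps1; nra.
Qed.

End Gauges.

(** * The modulus and the p-norm *)

Section ModulusTheory.
Variable R : realType.
Implicit Types x y : R[i].

Lemma modulus_ge0 x : 0 <= modulus x.
Proof. by case: x => u v; exact: sqrtr_ge0. Qed.

Lemma modulus0 : modulus (0 : R[i]) = 0.
Proof. exact: ComplexField.Normc.normc0. Qed.

Lemma modulus1 : modulus (1 : R[i]) = 1.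
Proof. exact: ComplexField.Normc.normc1. Qed.

Lemma modulus_eq0 x : (modulus x == 0) = (x == 0).
Proof.
by apply/eqP/eqP => [/ComplexField.Normc.eq0_normc//|->]; rewrite modulus0.
Qed.

Lemma modulus_gt0 x : (0 < modulus x) = (x != 0).
Proof. by rewrite lt_def modulus_ge0 modulus_eq0 andbT. Qed.

Lemma modulusM x y : modulus (x * y) = modulus x * modulus y.
Proof. exact: ComplexField.Normc.normcM. Qed.

Lemma modulusV x : modulus x^-1 = (modulus x)^-1.
Proof. exact: ComplexField.Normc.normcV. Qed.

Lemma modulusN x : modulus (- x) = modulus x.
Proof. exact: normcN. Qed.

Lemma modulusB x y : modulus (x - y) = modulus (y - x).
Proof. by rewrite -modulusN opprB. Qed.

Lemma ler_modulusD x y : modulus (x + y) <= modulus x + modulus y.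
Proof. exact: le_normcD. Qed.

Lemma ler_modulusB x y : modulus x - modulus y <= modulus (x - y).
Proof. by rewrite lerBlDr; apply: le_trans (ler_modulusD _ _); rewrite subrK. Qed.

Lemma ler_modulus_sum (I : finType) (P : pred I) (F : I -> R[i]) :
  modulus (\sum_(i | P i) F i) <= \sum_(i | P i) modulus (F i).
Proof.
elim/big_ind2: _ => [|x1 x2 y1 y2 h1 h2|//]; first by rewrite modulus0.
by rewrite (le_trans (ler_modulusD _ _))// lerD.
Qed.

Lemma modulus_prod (I : finType) (P : pred I) (F : I -> R[i]) :
  modulus (\prod_(i | P i) F i) = \prod_(i | P i) modulus (F i).
Proof. exact: (big_morph _ modulusM modulus1). Qed.

Lemma modulus_real (u : R) : 0 <= u -> modulus u%:C = u.
Proof. by move=> u0; rewrite /modulus /= expr0n /= addr0 sqrtr_sqr ger0_norm. Qed.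

End ModulusTheory.

Section PNorm.
Variables (R : realType) (p q : \bar R).
Hypotheses (p_ge1 : (1 <= p)%E) (pq_conj : (p^-1 + q^-1 = 1)%E).

Lemma conjugate_fine_inv r : p = r%:E -> 1 <= r /\ fine (q^-1)%E = 1 - r^-1.
Proof.
move=> pr; move: p_ge1 pq_conj; rewrite pr lee_fin inver => r1.
have r0 : r != 0 by rewrite gt_eqF// (lt_le_trans ltr01).
rewrite (negPf r0); case: (q^-1)%E => [s| |]//= [e]; split => //.
by apply/eqP; rewrite eq_sym subr_eq addrC e.
Qed.

Lemma conjugate_fine_inv_bounds : 0 <= fine (q^-1)%E <= 1.
Proof.
case: p p_ge1 pq_conj conjugate_fine_inv => [r| |]//.
  move=> r1 _ /(_ r erefl)[_ ->].
  rewrite lee_fin in r1.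
  have r0 : 0 < r by rewrite (lt_le_trans ltr01).
  by rewrite subr_ge0 gerBl invf_le1// r1 invr_ge0 ltW.
by rewrite invey add0e => _ -> _ /=; rewrite ler01 lexx.
Qed.

(** The tangent line of t^r at 1, obtained from Young's inequality with one
    factor equal to 1. *)
Lemma powR_bernoulli (r t : R) : 1 <= r -> 0 <= t -> 1 + r * (t - 1) <= t `^ r.
Proof.
rewrite le_eqVlt => /predU1P[<-|r1] t0; first by rewrite powRr1//; lra.
have r0 : 0 < r by apply: lt_trans r1.
have s0 : 0 < 1 - r^-1 by rewrite subr_gt0 invf_lt1.
have pq : r^-1 + ((1 - r^-1)^-1)^-1 = 1 by rewrite invrK addrC subrK.
have s0' : 0 < (1 - r^-1)^-1 by rewrite invr_gt0.
have := conjugate_powR t0 ler01 r0 s0' pq.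
rewrite powR1 mulr1 mul1r invrK => H.
have {}H := ler_wpM2l (ltW r0) H; move: H.
rewrite (_ : r * (t `^ r / r + (1 - r^-1)) = t `^ r + (r - 1)); first by lra.
by field; rewrite gt_eqF.
Qed.

(** Summing [powR_bernoulli] over the ratios x_i / M, where M is the arithmetic
    mean, the linear terms cancel. *)
Lemma power_mean (I : finType) (A : {pred I}) (x : I -> R) (r : R) : 1 <= r ->
  (forall i, 0 <= x i) ->
  \sum_(i in A) x i <=
    #|A|%:R `^ (1 - r^-1) * (\sum_(i in A) x i `^ r) `^ r^-1.
Proof.
move=> r1 x0; set S := \sum_(i in A) x i; set T := \sum_(i in A) _.
have r0 : 0 < r by rewrite (lt_le_trans ltr01).
have S0 : 0 <= S by apply: sumr_ge0.
have T0 : 0 <= T by apply: sumr_ge0 => i _; exact: powR_ge0.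
move: S0; rewrite le_eqVlt => /predU1P[<-|S0].
  by rewrite mulr_ge0// powR_ge0.
set N : R := #|A|%:R.
have N0 : 0 < N.
  rewrite /N ltr0n lt0n; apply/eqP => /card0_eq A0.
  by move: S0; rewrite /S big_pred0 ?ltxx// => i; exact: A0.
set M := S / N; have M0 : 0 < M by exact: divr_gt0.
have NMT : N * M `^ r <= T.
  have : \sum_(i in A) (1 + r * (x i / M - 1)) <= \sum_(i in A) (x i / M) `^ r.
    apply: ler_sum => i _; apply: powR_bernoulli => //.
    by rewrite divr_ge0// ltW.
  rewrite big_split /= sumr_const -/N -mulr_sumr big_split /= sumrN sumr_const.
  rewrite -mulr_suml -/S -/N.
  have -> : S / M - N = 0 by rewrite /M; field; rewrite !gt_eqF.
  rewrite mulr0 addr0.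
  have -> : \sum_(i in A) (x i / M) `^ r = T / M `^ r.
    rewrite /T mulr_suml; apply: eq_bigr => i _.
    have Mr0 : M `^ r != 0 by rewrite gt_eqF// powR_gt0.
    apply: (mulIf Mr0); rewrite divfK// -powRM ?(ltW M0)//;
      last exact: divr_ge0 (x0 i) (ltW M0).
    by rewrite divfK// gt_eqF.
  by rewrite ler_pdivlMr ?powR_gt0.
have -> : S = N `^ (1 - r^-1) * (N * M `^ r) `^ r^-1.
  rewrite powRM ?powR_ge0 ?ltW// -powRrM mulfV ?gt_eqF// powRr1 ?(ltW M0)//.
  rewrite mulrA -powRD; last by rewrite (gt_eqF N0) implybT.
  by rewrite subrK powRr1 ?ltW// /M mulrC divfK// gt_eqF.
apply: ler_wpM2l; first exact: powR_ge0.
apply: ge0_ler_powR => //; rewrite ?nnegrE ?invr_ge0 ?(ltW r0)//.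
by rewrite mulr_ge0 ?powR_ge0 ?(ltW N0).
Qed.

Variable n : nat.
Implicit Types x y : 'rV[R[i]]_n.

Lemma pnorm_ge0 x : 0 <= pnorm p x.
Proof.
by case: p => [r| |] /=; rewrite ?powR_ge0// bigmax_ge_id.
Qed.

(** The device by which componentwise estimates become estimates in p-norm. *)
Lemma pnorm_le x y (c : R) : 0 <= c ->
  (forall i, modulus (x 0 i) <= c * modulus (y 0 i)) ->
  pnorm p x <= c * pnorm p y.
Proof.
move=> c0 xy; case: p p_ge1 => [r| |]//=.
- rewrite lee_fin => r1; have r0 : 0 < r by rewrite (lt_le_trans ltr01).
  have S0 z : 0 <= \sum_(i < n) modulus (z 0 i : R[i]) `^ r.
    by apply: sumr_ge0 => i _; exact: powR_ge0.
  have -> : c * (\sum_(i < n) modulus (y 0 i) `^ r) `^ r^-1 =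
            (\sum_(i < n) (c * modulus (y 0 i)) `^ r) `^ r^-1.
    under [in RHS]eq_bigr do rewrite powRM ?modulus_ge0//.
    rewrite -mulr_sumr powRM ?powR_ge0// -powRrM mulfV ?gt_eqF// powRr1//.
  apply: ge0_ler_powR; rewrite ?nnegrE ?invr_ge0 ?(ltW r0) ?S0//.
    by apply: sumr_ge0 => i _; exact: powR_ge0.
  apply: ler_sum => i _; apply: ge0_ler_powR; rewrite ?nnegrE ?(ltW r0)//.
  - exact: modulus_ge0.
  - by rewrite mulr_ge0 ?modulus_ge0.
- move=> _; apply: bigmax_le => [|i _].
    by rewrite mulr_ge0// bigmax_ge_id.
  apply: le_trans (xy i) _; apply: ler_wpM2l => //.
  exact: (le_bigmax _ (fun i => modulus (y 0 i))).
Qed.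

(** Hölder's inequality against an indicator function. Its instances for the
    complement of a point and for a pair of points are the origin of the
    coefficients a and b. *)
Lemma sum_modulus_le_pnorm x (A : {pred 'I_n}) :
  \sum_(i in A) modulus (x 0 i) <= #|A|%:R `^ fine (q^-1)%E * pnorm p x.
Proof.
case: p p_ge1 pq_conj conjugate_fine_inv => [r| |]//=.
- move=> _ _ /(_ r erefl)[r1 ->].
  have r0 : 0 < r by rewrite (lt_le_trans ltr01).
  apply: le_trans (power_mean _ r1 _) _ => [i|]; first exact: modulus_ge0.
  apply: ler_wpM2l; first exact: powR_ge0.
  have P0 i : 0 <= modulus (x 0 i) `^ r by exact: powR_ge0.
  apply: ge0_ler_powR; rewrite ?nnegrE ?invr_ge0 ?(ltW r0) ?sumr_ge0//.
  by rewrite [leRHS](bigID (mem A)) /= lerDl sumr_ge0.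
- rewrite invey add0e => _ -> _ /=; rewrite powRr1// mulrC mulr_natr -sumr_const.
  by apply: ler_sum => i _; exact: (le_bigmax _ (fun i => modulus (x 0 i))).
Qed.

Lemma modulus_le_pnorm x i : modulus (x 0 i) <= pnorm p x.
Proof.
by have := sum_modulus_le_pnorm x (pred1 i); rewrite big_pred1_eq card1 powR1 mul1r.
Qed.

Lemma modulus_pair_le_pnorm x i j : i != j ->
  modulus (x 0 i) + modulus (x 0 j) <= coef_b q * pnorm p x.
Proof.
move=> ij; have := sum_modulus_le_pnorm x (pred2 i j).
rewrite card2 ij /= (bigD1 i) ?inE ?eqxx//= (big_pred1 j)// => k.
by rewrite !inE; have [->|] := eqVneq k i; rewrite ?(negPf ij) ?andbT.
Qed.

Lemma modulus_others_le_pnorm x i :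
  \sum_(j < n | j != i) modulus (x 0 j) <= coef_a n q * pnorm p x.
Proof.
have := sum_modulus_le_pnorm x (predC1 i).
by rewrite cardC1 card_ord -subn1.
Qed.

End PNorm.

(** * Separation of the components *)

Section Separation.
Variables (R : realType) (n : nat).
Hypothesis n_ge2 : (2 <= n)%N.
Implicit Type z : 'rV[R[i]]_n.

Lemma other_index (i : 'I_n) : exists j : 'I_n, j != i.
Proof.
case: n n_ge2 i => [|[|k]]// _ i.
by exists (lift i ord0); rewrite eq_sym neq_lift.
Qed.

Lemma separation_attained z i :
  exists2 j, j != i & separation z i = modulus (z 0 i - z 0 j).
Proof.
have [j0 ji] := other_index i.
pose F j := (modulus (z 0 i - z 0 j))%:E.
rewrite /separation; have [|j jP ->] := 
  eq_bigmin (x := +oo%E) j0 (fun k => k != i) F ji.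
  by move=> k _; rewrite leey.
by exists j.
Qed.

Lemma separation_le z i j : j != i -> separation z i <= modulus (z 0 i - z 0 j).
Proof.
move=> ji; rewrite /separation -lee_fin.
pose F j := (modulus (z 0 i - z 0 j))%:E.
have [|k kP H] := eq_bigmin (x := +oo%E) j (fun k => k != i) F ji.
  by move=> k _; rewrite leey.
by rewrite H /= -/(F k) -H; exact: bigmin_le_cond.
Qed.

Lemma separation_ge z i (c : R) :
  (forall j, j != i -> c <= modulus (z 0 i - z 0 j)) -> c <= separation z i.
Proof. by move=> H; have [j ji ->] := separation_attained z i; exact: H. Qed.

Lemma separation_gt0 z i : distinct_components z -> 0 < separation z i.
Proof.
move=> zi; have [j ji ->] := separation_attained z i.
rewrite modulus_gt0 subr_eq0; apply: contra ji => /eqP e.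
by apply/eqP; exact: (zi j i (esym e)).
Qed.

End Separation.

(** * Weierstrass corrections and interpolation *)

Section WeierstrassIdentities.
Variables (R : realType) (n : nat) (f : {poly R[i]}).
Hypotheses (f_monic : f \is monic) (f_deg : size f = n.+1).
Variable z : 'rV[R[i]]_n.
Hypothesis z_inj : distinct_components z.

Local Notation W := (weierstrass f z 0).

Lemma neq_components i j : j != i -> z 0 i - z 0 j != 0.
Proof.
move=> ji; rewrite subr_eq0; apply: contra ji => /eqP e; apply/eqP.
exact: (z_inj (esym e)).
Qed.

(** Lagrange interpolation of f - prod_j ('X - z_j), of degree less than n, at the
    components of z. *)
Lemma weierstrass_interpolation : f = \prod_j ('X - (z 0 j)%:P) +
  \sum_j W j *: \prod_(k | k != j) ('X - (z 0 k)%:P).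
Proof.
set g := \prod_j _; set h := \sum_j _.
have g_size : size g = n.+1.
  by rewrite /g size_prod_XsubC /index_enum -enumT size_enum_ord.
have g_monic : g \is monic by exact: monic_prod_XsubC.
have h_size : (size h <= n)%N.
  apply: (leq_trans (size_sum _ _ _)); apply/bigmax_leqP => j _.
  apply: leq_trans (size_scale_leq _ _) _.
  have gE : g = \prod_(k | k != j) ('X - (z 0 k)%:P) * ('X - (z 0 j)%:P).
    by rewrite /g (bigD1 j)//= mulrC.
  rewrite -ltnS -g_size gE size_Mmonic ?monicXsubC//.
    by rewrite size_XsubC addn2.
  by apply/prodf_neq0 => k _; rewrite polyXsubC_eq0.
apply/eqP; rewrite -subr_eq0 opprD addrA; apply/negP => /negP ne0.
have fg_size : (size (f - g - h)%R <= n)%N.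
  apply: leq_trans (size_polyD _ _) _; rewrite size_polyN geq_max h_size andbT.
  apply/leq_sizeP => k; rewrite leq_eqVlt => /predU1P[<-|nk].
    move: f_monic g_monic; rewrite !monicE !lead_coefE f_deg g_size /= coefB.
    by move=> /eqP -> /eqP ->; rewrite subrr.
  by rewrite coefB !nth_default ?subrr// ?f_deg ?g_size.
have roots : all (root (f - g - h)) [seq z 0 i | i <- enum 'I_n].
  apply/allP => _ /mapP[i _ ->]; rewrite /root !hornerE.
  have -> : g.[z 0 i] = 0.
    by rewrite /g (bigD1 i)//= hornerM hornerXsubC subrr mul0r.
  suff -> : h.[z 0 i] = f.[z 0 i] by rewrite subr0 subrr.
  rewrite /h horner_sum (bigD1 i)//= [X in _ + X]big1 ?addr0 => [|j ji].
    rewrite hornerZ horner_prod mxE.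
    under [X in _ * X]eq_bigr do rewrite hornerXsubC.
    by rewrite divfK//; apply/prodf_neq0 => k ki; exact: neq_components.
  rewrite hornerZ (bigD1 i) 1?[i == j]eq_sym//= hornerM hornerXsubC subrr mul0r.
  by rewrite mulr0.
have := max_poly_roots ne0 roots.
rewrite map_inj_uniq ?enum_uniq// size_map size_enum_ord ltnNge fg_size.
by move=> /(_ isT).
Qed.

Lemma horner_weierstrass x : f.[x] = \prod_j (x - z 0 j) +
  \sum_j W j * \prod_(k | k != j) (x - z 0 k).
Proof.
rewrite {1}weierstrass_interpolation hornerD horner_prod horner_sum.
congr (_ + _); first by apply: eq_bigr => j _; rewrite hornerXsubC.
apply: eq_bigr => j _; rewrite hornerZ horner_prod; congr (_ * _).
by apply: eq_bigr => k _; rewrite hornerXsubC.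
Qed.

(** The cancellation behind the method. Let e be the increment of the i-th
    component and s the sum in its denominator, so that W_i = - e (1 + s). In
    [horner_weierstrass] at zh_i, after division by the product over j <> i and
    by e, the i-th term contributes - (1 + s) and cancels both the leading 1 and,
    up to first order, the remaining sum. What is left is s e times a sum; each of
    s, e / d_i and d_i times that sum is of order E. *)
Lemma horner_nourein i (zh := nourein f z) : nourein_domain f z ->
  (forall j, j != i -> zh 0 i - z 0 j != 0) ->
  f.[zh 0 i] = (zh 0 i - z 0 i) *
    ((nourein_denom f z i - 1) * (zh 0 i - z 0 i) *
     \sum_(j | j != i) W j / ((zh 0 i - z 0 j) * (z 0 i - z 0 j - W i))) *
    \prod_(j | j != i) (zh 0 i - z 0 j).
Proof.
move=> [_ D_neq0 /(_ i) den_neq0] zh_neq.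
set e := zh 0 i - z 0 i; set P := \prod_(j | j != i) _.
set s := nourein_denom f z i - 1.
have den : nourein_denom f z i = 1 + s by rewrite addrC subrK.
have We : W i = - (e * (1 + s)).
  have -> : e = - (W i / nourein_denom f z i).
    by rewrite /e [zh 0 i]mxE addrAC subrr add0r.
  by rewrite mulNr opprK -den divfK.
have sE : s = \sum_(j < n | j != i) W j / (z 0 i - z 0 j - W i).
  by apply/eqP; rewrite subr_eq addrC.
rewrite horner_weierstrass (bigD1 i)//= [X in _ + X](bigD1 i)//= -/e -/P.
have -> : \sum_(j < n | j != i) W j * \prod_(k | k != j) (zh 0 i - z 0 k) =
   P * (e * \sum_(j < n | j != i) W j / (zh 0 i - z 0 j)).
  rewrite !mulr_sumr; apply: eq_bigr => j ji.
  have PE : P = (zh 0 i - z 0 j) * \prod_(k | (k != i) && (k != j)) (zh 0 i - z 0 k).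
    by rewrite /P (bigD1 j).
  have -> : \prod_(k | k != j) (zh 0 i - z 0 k) =
      e * \prod_(k | (k != i) && (k != j)) (zh 0 i - z 0 k).
    rewrite (bigD1 i) 1?[i == j]eq_sym//=; congr (_ * _).
    by apply: eq_bigl => k; rewrite andbC.
  by rewrite PE; field; exact: zh_neq.
have -> : e * P + (W i * P + P * (e * \sum_(j < n | j != i) W j / (zh 0 i - z 0 j)))
   = P * e * (\sum_(j < n | j != i) W j / (zh 0 i - z 0 j) - s).
  by rewrite We; ring.
rewrite [X in _ - X]sE -sumrB.
have -> : \sum_(j < n | j != i)
    (W j / (zh 0 i - z 0 j) - W j / (z 0 i - z 0 j - W i)) =
   s * e * \sum_(j < n | j != i) W j / ((zh 0 i - z 0 j) * (z 0 i - z 0 j - W i)).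
  rewrite mulr_sumr; apply: eq_bigr => j ji.
  have -> : s * e = (z 0 i - z 0 j - W i) - (zh 0 i - z 0 j).
    by rewrite We; apply/eqP; rewrite -subr_eq0 /e; apply/eqP; ring.
  by field; rewrite zh_neq// D_neq0.
by rewrite [RHS]mulrC !mulrA.
Qed.

End WeierstrassIdentities.

(** * One step of the iteration *)

Section NoureinStep.
Variables (R : realType) (n : nat) (f : {poly R[i]}) (p q : \bar R).
Hypothesis n_ge2 : (2 <= n)%N.
Hypotheses (f_monic : f \is monic) (f_deg : size f = n.+1).
Hypotheses (p_ge1 : (1 <= p)%E) (pq_conj : (p^-1 + q^-1 = 1)%E).

Local Notation a := (coef_a n q).
Local Notation b := (coef_b q).
Local Notation m := (coef_m n q).
Local Notation phi := (Defs.phi n q).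
Local Notation psi := (Defs.psi n q).
Local Notation mu := (Defs.mu n q).

Lemma coef_bounds : [/\ 1 <= a, 1 <= b & b <= 2].
Proof.
have /andP[q0 q1] := conjugate_fine_inv_bounds p_ge1 pq_conj.
by split; [exact: coef_a_ge1|exact: coef_b_ge1|exact: coef_b_le2].
Qed.

Let coefs := coef_bounds.

Variable z : 'rV[R[i]]_n.
Hypothesis z_inj : distinct_components z.

Local Notation W := (weierstrass f z 0).
Local Notation E := (initialE p f z).
Local Notation d := (separation z).

Hypothesis E_small : E < gauge_radius n q.

Let E_ge0 : 0 <= E. Proof. exact: pnorm_ge0. Qed.

(** The entries of the vector whose norm is E; all bounds below are expressed
    through them and E. *)
Let rel (i : 'I_n) : R := modulus (W i) / d i.

Let d_gt0 i : 0 < d i. Proof. exact: separation_gt0. Qed.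

Let rel_ge0 i : 0 <= rel i.
Proof. by rewrite divr_ge0 ?modulus_ge0 ?ltW. Qed.

Let W_rel i : modulus (W i) = rel i * d i.
Proof. by rewrite divfK// gt_eqF. Qed.

Let relE i : modulus ((\row_(i < n) (W i / (d i)%:C)) 0 i) = rel i.
Proof. by rewrite mxE modulusM modulusV modulus_real ?ltW. Qed.

Let rel_le i : rel i <= E.
Proof. by rewrite -relE; exact: (modulus_le_pnorm p_ge1 pq_conj). Qed.

Let rel_pair i j : i != j -> rel i + rel j <= b * E.
Proof. by rewrite -!relE; exact: (modulus_pair_le_pnorm p_ge1 pq_conj). Qed.

Let rel_sum i : \sum_(j < n | j != i) rel j <= a * E.
Proof.
under eq_bigr do rewrite -relE.
exact: (modulus_others_le_pnorm p_ge1 pq_conj).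
Qed.

Let dist i j : R := modulus (z 0 i - z 0 j).

Let d_le i j : j != i -> d i <= dist i j.
Proof. exact: separation_le. Qed.

Let d_le' i j : j != i -> d j <= dist i j.
Proof. by move=> ji; rewrite /dist modulusB separation_le// eq_sym. Qed.

Let dist_gt0 i j : j != i -> 0 < dist i j.
Proof. by move=> ji; exact: lt_le_trans (d_gt0 i) (d_le ji). Qed.

Let W_le i j : j != i -> modulus (W i) <= rel i * dist i j.
Proof. by move=> ji; rewrite W_rel ler_wpM2l ?d_le. Qed.

Let W_le' i j : j != i -> modulus (W j) <= rel j * dist i j.
Proof. by move=> ji; rewrite W_rel ler_wpM2l ?d_le'. Qed.

Let E_lt1 : 0 < 1 - E.
Proof.
by have := below_radius_half coefs E_ge0 E_small; rewrite subr_gt0 => H; lra.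
Qed.

Let D0 : 0 < 1 - (a + 1) * E.
Proof. by have [] := below_radius coefs E_ge0 E_small. Qed.

Let corrected_ge i j : j != i ->
  dist i j * (1 - E) <= modulus (z 0 i - z 0 j - W i).
Proof.
move=> ji; apply: le_trans (ler_modulusB _ _); rewrite -/(dist i j).
have := W_le ji; have : rel i * dist i j <= E * dist i j.
  by rewrite ler_wpM2r// ltW// dist_gt0.
lra.
Qed.

Let corrected_neq0 i j : j != i -> z 0 i - z 0 j - W i != 0.
Proof.
move=> ji; rewrite -modulus_gt0; apply: lt_le_trans (corrected_ge ji).
by rewrite mulr_gt0// dist_gt0.
Qed.

Let s (i : 'I_n) : R[i] := nourein_denom f z i - 1.

Let s_le i : modulus (s i) <= a * E / (1 - E).
Proof.
rewrite /s /nourein_denom addrC addKr.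
apply: le_trans (ler_modulus_sum _ _) _.
have : \sum_(j < n | j != i) rel j / (1 - E) <= a * E / (1 - E).
  by rewrite -mulr_suml ler_wpM2r// invr_ge0 ltW.
apply: le_trans; apply: ler_sum => j ji.
have dij := dist_gt0 ji.
rewrite modulusM modulusV ler_pdivrMr; last by rewrite modulus_gt0 corrected_neq0.
rewrite mulrAC ler_pdivlMr//.
apply: le_trans (_ : rel j * (dist i j * (1 - E)) <= _).
  by rewrite mulrA ler_wpM2r ?(ltW E_lt1) ?W_le'.
by rewrite ler_wpM2l// corrected_ge.
Qed.

(** Hence |1 + s_i| >= 1 - a E / (1 - E), which is 1 / mu(E). *)
Let denom_ge i : (mu E)^-1 <= modulus (nourein_denom f z i).
Proof.
have -> : (mu E)^-1 = 1 - a * E / (1 - E).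
  by rewrite /Defs.mu; field; rewrite ?gt_eqF.
have := ler_modulusB 1 (- s i).
have -> : 1 - - s i = nourein_denom f z i by rewrite opprK /s addrC subrK.
rewrite modulus1 modulusN.
by have := s_le i; lra.
Qed.

Let mu_gt0 : 0 < mu E.
Proof. exact: lt_le_trans ltr01 (mu_ge1 coefs E_ge0 E_small). Qed.

Let denom_neq0 i : nourein_denom f z i != 0.
Proof.
by rewrite -modulus_gt0; apply: lt_le_trans (denom_ge i); rewrite invr_gt0.
Qed.

Lemma nourein_domain_below_radius : nourein_domain f z.
Proof. by split. Qed.

Local Notation zh := (nourein f z).

Lemma nourein_increment_le i :
  modulus (zh 0 i - z 0 i) <= mu E * modulus (W i).
Proof.
rewrite mxE addrAC subrr add0r modulusN modulusM modulusV mulrC.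
rewrite ler_wpM2r ?modulus_ge0//.
by rewrite -[leRHS]invrK lef_pV2 ?posrE ?invr_gt0 ?modulus_gt0.
Qed.

Let increment_le i j : j != i ->
  modulus (zh 0 i - z 0 i) <= mu E * rel i * dist i j.
Proof.
move=> ji; apply: le_trans (nourein_increment_le i) _.
by rewrite -mulrA ler_wpM2l ?(ltW mu_gt0) ?W_le.
Qed.

Lemma weierstrass_pair_le i j : j != i ->
  modulus (W i) + modulus (W j) <= b * E * modulus (z 0 i - z 0 j).
Proof.
move=> ji; apply: le_trans (lerD (W_le ji) (W_le' ji)) _.
by rewrite -mulrDl ler_wpM2r ?modulus_ge0// rel_pair// eq_sym.
Qed.

Lemma weierstrass_le_dist i j : j != i ->
  modulus (W j) <= E * modulus (z 0 i - z 0 j).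
Proof.
by move=> ji; apply: le_trans (W_le' ji) _; rewrite ler_wpM2r ?modulus_ge0.
Qed.

Lemma nourein_distance_ge i j :
  psi E * modulus (z 0 i - z 0 j) <= modulus (zh 0 i - zh 0 j).
Proof.
have [->|ji] := eqVneq j i; first by rewrite !subrr modulus0 mulr0.
have -> : zh 0 i - zh 0 j =
   (z 0 i - z 0 j) - ((zh 0 j - z 0 j) - (zh 0 i - z 0 i)) by ring.
apply: le_trans (ler_modulusB _ _); rewrite -/(dist i j).
have H1 := ler_modulusD (zh 0 j - z 0 j) (- (zh 0 i - z 0 i)).
rewrite modulusN in H1.
have H2 := nourein_increment_le i; have H3 := nourein_increment_le j.
have := ler_wpM2l (ltW mu_gt0) (weierstrass_pair_le ji); rewrite -/(dist i j).
by rewrite (psiE coefs E_ge0 E_small); lra.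
Qed.

Let psi0 : 0 < psi E. Proof. exact: (psi_gt0 coefs). Qed.

Lemma nourein_distinct : distinct_components zh.
Proof.
move=> i j /= e; apply/eqP; apply: contraT => ij; have := nourein_distance_ge j i.
by rewrite e subrr modulus0 leNgt mulr_gt0// -/(dist j i) dist_gt0.
Qed.

Let muE1 : 1 - mu E * E = (1 - (a + 2) * E + E ^+ 2) / (1 - (a + 1) * E).
Proof. by rewrite /Defs.mu; field; rewrite gt_eqF. Qed.

Let muE1_gt0 : 0 < 1 - mu E * E.
Proof.
rewrite muE1; have [_ _ _ ?] := below_radius coefs E_ge0 E_small.
by rewrite divr_gt0.
Qed.

Let mixed_ge i j : j != i ->
  (1 - mu E * E) * dist i j <= modulus (zh 0 i - z 0 j).
Proof.
move=> ji.
have -> : zh 0 i - z 0 j = (z 0 i - z 0 j) - (z 0 i - zh 0 i) by ring.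
apply: le_trans (ler_modulusB _ _); rewrite -/(dist i j) (modulusB (z 0 i)).
have H := increment_le ji.
have := ler_wpM2r (ltW (dist_gt0 ji)) (ler_wpM2l (ltW mu_gt0) (rel_le i)).
lra.
Qed.

Let mixed_neq0 i j : j != i -> zh 0 i - z 0 j != 0.
Proof.
move=> ji; rewrite -modulus_gt0; apply: lt_le_trans (mixed_ge ji).
by rewrite mulr_gt0 ?dist_gt0.
Qed.

(** One factor |z_i - z_j| is used to absorb W_j, the other one is bounded below
    by d_i; this keeps the division by d_i available to absorb a factor W_i. *)
Let quotient_sum_le i :
  modulus (\sum_(j < n | j != i)
    W j / ((zh 0 i - z 0 j) * (z 0 i - z 0 j - W i))) <=
  a * E / (d i * ((1 - mu E * E) * (1 - E))).
Proof.
set K := (1 - mu E * E) * (1 - E).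
have K0 : 0 < K by exact: mulr_gt0.
apply: le_trans (ler_modulus_sum _ _) _.
have : \sum_(j < n | j != i) rel j / (d i * K) <= a * E / (d i * K).
  by rewrite -mulr_suml ler_wpM2r// invr_ge0 ltW// mulr_gt0.
apply: le_trans; apply: ler_sum => j ji.
have dij := dist_gt0 ji.
rewrite modulusM modulusV modulusM ler_pdivrMr; last first.
  by rewrite mulr_gt0// modulus_gt0 ?mixed_neq0 ?corrected_neq0.
rewrite mulrAC ler_pdivlMr; last by rewrite mulr_gt0.
apply: le_trans (_ : rel j * ((1 - mu E * E) * dist i j * (dist i j * (1 - E)))
                     <= _); last first.
  apply: ler_wpM2l => //; apply: ler_pM; rewrite ?mixed_ge ?corrected_ge//.
    by rewrite mulr_ge0 ?ltW.
  by rewrite mulr_ge0 ?ltW.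
apply: le_trans (_ : (rel j * dist i j) * (dist i j * K) <= _).
  apply: ler_pM; rewrite ?modulus_ge0 ?W_le'//.
    by rewrite mulr_ge0 ?ltW.
  by rewrite ler_wpM2r ?d_le// ltW.
by rewrite /K le_eqVlt; apply/orP; left; apply/eqP; ring.
Qed.

Let growth_base : R :=
  1 + 1 / (n - 1)%:R * (a * (E - E ^+ 2) / (1 - m * E + b * E ^+ 2)).

Let D1 : 0 < 1 - m * E + b * E ^+ 2.
Proof. by have [] := below_radius coefs E_ge0 E_small. Qed.

(** The factors are at most 1 + c (|W_j| / d_j) with c = mu / psi, and the
    inequality of arithmetic and geometric means turns the product into a power
    of their mean, where the sum over j <> i is controlled by a E. *)
Let ratio_prod_le i :
  \prod_(j < n | j != i) modulus ((zh 0 i - z 0 j) / (zh 0 i - zh 0 j)) <=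
  growth_base ^+ (n - 1).
Proof.
set c := mu E / psi E; have c0 : 0 <= c by rewrite divr_ge0// ltW.
have n1 : 0 < (n - 1)%:R :> R by rewrite ltr0n subn_gt0.
have step : \prod_(j < n | j != i) modulus ((zh 0 i - z 0 j) / (zh 0 i - zh 0 j))
    <= \prod_(j < n | j != i) (1 + c * rel j).
  apply: ler_prod => j ji; rewrite modulus_ge0 /=.
  have zhij : 0 < modulus (zh 0 i - zh 0 j).
    apply: lt_le_trans (nourein_distance_ge i j); rewrite mulr_gt0//.
    by rewrite -/(dist i j) dist_gt0.
  rewrite modulusM modulusV ler_pdivrMr// mulrDl mul1r.
  have -> : zh 0 i - z 0 j = (zh 0 i - zh 0 j) + (zh 0 j - z 0 j) by ring.
  apply: le_trans (ler_modulusD _ _) _; rewrite lerD2l.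
  have ij : i != j by rewrite eq_sym.
  apply: le_trans (increment_le ij) _.
  have -> : dist j i = dist i j by exact: modulusB.
  rewrite (_ : c * rel j * _ =
    mu E * (rel j * (modulus (zh 0 i - zh 0 j) / psi E))); last by rewrite /c; ring.
  rewrite -mulrA ler_wpM2l ?(ltW mu_gt0)// ler_wpM2l//.
  by rewrite ler_pdivlMr// mulrC nourein_distance_ge.
apply: le_trans step _.
have card : #|predC1 i| = (n - 1)%N by rewrite cardC1 card_ord subn1.
have := (@leif_AGM R _ (predC1 i) (fun j => 1 + c * rel j)).
rewrite card => /(_ (fun j _ => addr_ge0 ler01 (mulr_ge0 c0 (rel_ge0 j)))) [H _].
apply: le_trans H _.
have sum_ge0 : 0 <= \sum_(j < n | j != i) rel j by exact: sumr_ge0.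
have -> : \sum_(j in predC1 i) (1 + c * rel j) =
    (n - 1)%:R + c * \sum_(j < n | j != i) rel j.
  by rewrite big_split /= sumr_const card mulr_sumr.
apply: lerXn2r; rewrite ?nnegrE.
- apply: divr_ge0; last exact: ltW.
  by apply: addr_ge0; [exact: ltW|exact: mulr_ge0].
- rewrite addr_ge0// mulr_ge0 ?divr_ge0 ?(ltW n1) ?(ltW D1)// mulr_ge0//.
    by have [a1 _ _] := coefs; exact: le_trans ler01 a1.
  have -> : E - E ^+ 2 = E * (1 - E) by ring.
  by rewrite mulr_ge0// ltW.
rewrite mulrDl divff ?gt_eqF// lerD2l mulrC div1r ler_wpM2l ?invr_ge0 ?(ltW n1)//.
apply: le_trans (ler_wpM2l c0 (rel_sum i)) _.
rewrite le_eqVlt; apply/orP; left; apply/eqP.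
by rewrite /c /Defs.psi /Defs.mu; field; rewrite !gt_eqF.
Qed.

(** The third-order smallness of [horner_nourein] made quantitative: of the three
    factors E, one comes from s, one from the increment relative to d_i and one
    from the remaining sum. *)
Lemma nourein_weierstrass_le i :
  modulus (weierstrass f zh 0 i) <= psi E * phi E * modulus (W i).
Proof.
have a0 : 0 <= a by have [a1 _ _] := coefs; exact: le_trans ler01 a1.
have dom := nourein_domain_below_radius.
have -> : weierstrass f zh 0 i = (zh 0 i - z 0 i) *
    ((nourein_denom f z i - 1) * (zh 0 i - z 0 i) *
     \sum_(j | j != i) W j / ((zh 0 i - z 0 j) * (z 0 i - z 0 j - W i))) *
    \prod_(j | j != i) ((zh 0 i - z 0 j) / (zh 0 i - zh 0 j)).
  rewrite mxE (horner_nourein f_monic f_deg z_inj dom); last first.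
    by move=> j; exact: mixed_neq0.
  by rewrite prodf_div -[LHS]mulrA.
rewrite !modulusM modulus_prod (psi_phiE coefs E_ge0 E_small) -/growth_base.
have A := nourein_increment_le i; have B := quotient_sum_le i.
have C := ratio_prod_le i; have S := s_le i.
have [_ _ _ D2] := below_radius coefs E_ge0 E_small.
have muW : 0 <= mu E * modulus (W i) by rewrite mulr_ge0 ?modulus_ge0 ?(ltW mu_gt0).
have sE : 0 <= a * E / (1 - E) by rewrite divr_ge0 ?mulr_ge0 ?(ltW E_lt1).
set g := growth_base ^+ (n - 1) in C *.
have g0 : 0 <= g by apply: le_trans C; apply: prodr_ge0 => j _; exact: modulus_ge0.
apply: le_trans (_ : mu E * modulus (W i) * (a * E / (1 - E) * (mu E * modulus (W i)) *
   (a * E / (d i * ((1 - mu E * E) * (1 - E))))) * g <= _).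
  apply: ler_pM => //; first by rewrite !mulr_ge0 ?modulus_ge0.
    by apply: prodr_ge0 => j _; exact: modulus_ge0.
  apply: ler_pM; rewrite ?mulr_ge0 ?modulus_ge0//.
  apply: ler_pM; rewrite ?mulr_ge0 ?modulus_ge0//.
  by apply: ler_pM; rewrite ?modulus_ge0.
rewrite [leRHS]mulrAC; apply: ler_wpM2r => //.
have -> : mu E * modulus (W i) * (a * E / (1 - E) * (mu E * modulus (W i)) *
   (a * E / (d i * ((1 - mu E * E) * (1 - E))))) =
   a ^+ 2 * E ^+ 2 / ((1 - (a + 1) * E) * (1 - (a + 2) * E + E ^+ 2)) *
   modulus (W i) * rel i.
  rewrite muE1 W_rel /Defs.mu; field.
  by rewrite !gt_eqF.
set K := (1 - (a + 1) * E) * _.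
rewrite (_ : a ^+ 2 * E ^+ 3 / K * modulus (W i) =
  a ^+ 2 * E ^+ 2 / K * modulus (W i) * E); last by ring.
apply: ler_wpM2l => //; rewrite mulr_ge0 ?modulus_ge0//.
by rewrite divr_ge0 ?mulr_ge0 ?exprn_ge0// ltW// mulr_gt0.
Qed.

(** The factor psi in [nourein_weierstrass_le] is exactly compensated by the loss
    of separation in [nourein_distance_ge], leaving [phi]. *)
Lemma nourein_E_le : initialE p f zh <= phi E * E.
Proof.
apply: (pnorm_le p_ge1); first exact: (phi_ge0 coefs E_ge0 E_small).
move=> i; rewrite !relE mxE modulusM modulusV.
have dh : psi E * d i <= separation zh i.
  apply: separation_ge => // j ji; apply: le_trans (nourein_distance_ge i j).
  by apply: ler_wpM2l; [exact: ltW|exact: d_le].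
have dh0 : 0 < separation zh i by apply: lt_le_trans dh; rewrite mulr_gt0.
rewrite modulus_real; last exact: ltW.
rewrite ler_pdivrMr//.
apply: le_trans (nourein_weierstrass_le i) _; rewrite W_rel.
have := ler_wpM2l (mulr_ge0 (phi_ge0 coefs E_ge0 E_small) (rel_ge0 i)) dh.
by apply: le_trans; rewrite le_eqVlt; apply/orP; left; apply/eqP; ring.
Qed.

End NoureinStep.

(** * The iterates *)

Section NoureinIteration.
Variables (R : realType) (n : nat) (f : {poly R[i]}) (p q : \bar R).
Hypothesis n_ge2 : (2 <= n)%N.
Hypotheses (f_monic : f \is monic) (f_deg : size f = n.+1).
Hypotheses (p_ge1 : (1 <= p)%E) (pq_conj : (p^-1 + q^-1 = 1)%E).

Local Notation phi := (Defs.phi n q).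
Local Notation psi := (Defs.psi n q).
Local Notation mu := (Defs.mu n q).
Local Notation E := (@initialE R n p f).
Local Notation W := (@weierstrass R n f).

Let coefs := coef_bounds n_ge2 p_ge1 pq_conj.

(** The initial conditions, which are inherited by every iterate; thus each
    estimate from z^0 also holds with any z^k as starting point. *)
Definition good_start (z : 'rV[R[i]]_n) : Prop :=
  [/\ distinct_components z, E z < gauge_radius n q & phi (E z) <= 1].

Lemma initialE_ge0 z : 0 <= E z.
Proof. exact: pnorm_ge0. Qed.

Lemma good_start_step z : good_start z -> good_start (nourein f z).
Proof.
move=> [zi zr z1]; have E0 := initialE_ge0 z; have E0' := initialE_ge0 (nourein f z).
have Ele : E (nourein f z) <= phi (E z) * E z by exact: nourein_E_le.
have p0 := phi_ge0 coefs E0 zr.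
have p01 : 0 <= phi (E z) <= 1 by rewrite p0.
split; first exact: (nourein_distinct n_ge2 p_ge1 pq_conj).
  by apply: le_lt_trans zr; apply: le_trans Ele _; exact: ler_piMl.
apply: le_trans (phi_scale coefs p01 E0' Ele E0 zr) _.
by rewrite mulr_ile1// ?exprn_ge0// exprn_ile1.
Qed.

Lemma good_start_iter (z : 'rV[R[i]]_n) k :
  good_start z -> good_start (nourein_seq f z k).
Proof. by move=> H; elim: k => //= k; exact: good_start_step. Qed.

Lemma nourein_seqD (z : 'rV[R[i]]_n) k j :
  nourein_seq f z (j + k) = nourein_seq f (nourein_seq f z k) j.
Proof. exact: iterD. Qed.

(** The quotient (4^k - 1) / 3 is exact: it is 1 + 4 + ... + 4^(k-1), the
    accumulated exponent in the product of the rates lam^(4^i) for i < k. *)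
Lemma pow4_pred_div3 k : ((3 * ((4 ^ k - 1) %/ 3)).+1 = 4 ^ k)%N.
Proof.
have d : (3 %| 4 ^ k - 1)%N by rewrite -eqn_mod_dvd ?expn_gt0// -modnXm exp1n.
by rewrite mulnC divnK// subn1 prednK// expn_gt0.
Qed.

Lemma pow4_pred_div3S k : ((4 ^ k.+1 - 1) %/ 3 = 4 ^ k + (4 ^ k - 1) %/ 3)%N.
Proof.
apply/eqP; rewrite -(eqn_pmul2l (isT : 0 < 3)%N) -eqSS pow4_pred_div3 mulnDr.
by rewrite -addnS pow4_pred_div3 expnS -mulSnr.
Qed.

Variable z0 : 'rV[R[i]]_n.
Hypothesis z0_good : good_start z0.

Local Notation z := (nourein_seq f z0).
Local Notation lam := (phi (E z0)).
Local Notation theta := (psi (E z0)).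
Local Notation r := (theta * lam).

Let z0r : E z0 < gauge_radius n q. Proof. by case: z0_good. Qed.
Let E0 := initialE_ge0 z0.

Lemma lam_ge0 : 0 <= lam.
Proof. exact: (phi_ge0 coefs). Qed.

Lemma lam_le1 : lam <= 1.
Proof. by case: z0_good. Qed.

Lemma theta_gt0 : 0 < theta.
Proof. exact: (psi_gt0 coefs). Qed.

Lemma rate_ge0 : 0 <= r.
Proof. by rewrite mulr_ge0 ?lam_ge0 ?ltW ?theta_gt0. Qed.

Lemma rate_lt1 : r < 1.
Proof. exact: (psi_phi_lt1 coefs E0 z0r lam_le1). Qed.

Let lamX01 k : 0 <= lam ^+ k <= 1.
Proof. by rewrite exprn_ge0 ?lam_ge0//= exprn_ile1 ?lam_ge0 ?lam_le1. Qed.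

(** The scaling exponent 3 turns lam^((4^k - 1)/3) into lam^(4^k - 1), and the
    last factor lam is the value of [phi] at E(z^0). *)
Let step_rate k : E (z k) <= lam ^+ ((4 ^ k - 1) %/ 3) * E z0 ->
  phi (E (z k)) <= lam ^+ (4 ^ k) /\
  psi (E (z k)) * phi (E (z k)) <= theta * lam ^+ (4 ^ k).
Proof.
set e := ((4 ^ k - 1) %/ 3)%N => Ek; have Ek0 := initialE_ge0 (z k).
have pow : lam ^+ (4 ^ k) = (lam ^+ e) ^+ 3 * lam.
  by rewrite -pow4_pred_div3 exprSr mulnC exprM.
rewrite pow; split; first exact: (phi_scale coefs).
rewrite (_ : theta * _ = (lam ^+ e) ^+ 3 * (theta * lam)); last by ring.
exact: (psi_phi_scale coefs).
Qed.

Lemma nourein_seq_E_le k : E (z k) <= lam ^+ ((4 ^ k - 1) %/ 3) * E z0.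
Proof.
elim: k => [|k IH]; first by rewrite expn0 subnn div0n expr0 mul1r.
have [zi zr _] := good_start_iter k z0_good.
rewrite pow4_pred_div3S exprD -mulrA /=.
apply: le_trans (_ : phi (E (z k)) * E (z k) <= _).
  exact: nourein_E_le.
have [H _] := step_rate IH.
apply: ler_pM => //; last exact: initialE_ge0.
exact: (phi_ge0 coefs (initialE_ge0 _)).
Qed.

Lemma nourein_seq_rate_le k :
  psi (E (z k)) * phi (E (z k)) <= theta * lam ^+ (4 ^ k).
Proof. by have [] := step_rate (nourein_seq_E_le k). Qed.

Lemma nourein_seq_rate_le0 k : psi (E (z k)) * phi (E (z k)) <= r.
Proof.
apply: le_trans (nourein_seq_rate_le k) _; rewrite ler_wpM2l ?(ltW theta_gt0)//.
rewrite -(prednK (_ : 0 < 4 ^ k)%N) ?expn_gt0// exprS ler_piMr ?lam_ge0//.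
by case/andP: (lamX01 (4 ^ k).-1).
Qed.

Lemma nourein_seq_E_le0 k : E (z k) <= E z0.
Proof.
apply: le_trans (nourein_seq_E_le k) _; apply: ler_piMl => //.
by case/andP: (lamX01 ((4 ^ k - 1) %/ 3)).
Qed.

Lemma nourein_seq_W_step k i : modulus (W (z k.+1) 0 i) <=
  psi (E (z k)) * phi (E (z k)) * modulus (W (z k) 0 i).
Proof.
have [zi zr _] := good_start_iter k z0_good.
exact: (nourein_weierstrass_le n_ge2 f_monic f_deg p_ge1 pq_conj zi zr).
Qed.

(** The rate psi(E(z^k)) phi(E(z^k)) must be estimated as one function: the
    factor psi(E(z^k)) alone is at least theta, since [psi] is decreasing. *)
Lemma nourein_seq_W_le k i : modulus (W (z k) 0 i) <=
  theta ^+ k * lam ^+ ((4 ^ k - 1) %/ 3) * modulus (W z0 0 i).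
Proof.
elim: k => [|k IH]; first by rewrite expn0 subnn div0n !expr0 !mul1r.
apply: le_trans (nourein_seq_W_step k i) _.
rewrite pow4_pred_div3S exprD exprS.
rewrite (_ : theta * theta ^+ k * (lam ^+ (4 ^ k) * lam ^+ ((4 ^ k - 1) %/ 3)) * _ =
  (theta * lam ^+ (4 ^ k)) *
  (theta ^+ k * lam ^+ ((4 ^ k - 1) %/ 3) * modulus (W z0 0 i))); last by ring.
have [_ zr _] := good_start_iter k z0_good.
apply: ler_pM; rewrite ?modulus_ge0 ?nourein_seq_rate_le//.
have Ek0 := initialE_ge0 (z k).
by apply: mulr_ge0; [exact: (ltW (psi_gt0 coefs Ek0 zr))|exact: (phi_ge0 coefs)].
Qed.

Lemma nourein_seq_W_geometric k i :
  modulus (W (z k) 0 i) <= r ^+ k * modulus (W z0 0 i).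
Proof.
elim: k => [|k IH]; first by rewrite expr0 mul1r.
apply: le_trans (nourein_seq_W_step k i) _.
rewrite exprS -[leRHS]mulrA.
apply: ler_pM => //; rewrite ?modulus_ge0 ?nourein_seq_rate_le0//.
have Ek0 := initialE_ge0 (z k); have [_ zr _] := good_start_iter k z0_good.
by apply: mulr_ge0; [exact: (ltW (psi_gt0 coefs Ek0 zr))|exact: (phi_ge0 coefs)].
Qed.

Lemma nourein_seq_increment_le k i : modulus (z k.+1 0 i - z k 0 i) <=
  mu (E z0) * modulus (W z0 0 i) * r ^+ k.
Proof.
have [zi zr _] := good_start_iter k z0_good; have Ek0 := initialE_ge0 (z k).
apply: le_trans (nourein_increment_le n_ge2 p_ge1 pq_conj zi zr i) _.
rewrite -mulrA [_ * r ^+ k]mulrC; apply: ler_pM; rewrite ?modulus_ge0//.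
- exact: le_trans ler01 (mu_ge1 coefs Ek0 zr).
- exact: (mu_mono coefs Ek0 (nourein_seq_E_le0 k) z0r).
- exact: nourein_seq_W_geometric.
Qed.

End NoureinIteration.

(** * Limits of complex sequences *)

Section ComplexLimits.
Variable R : realType.
Implicit Types (u v : nat -> R[i]) (l c : R[i]).

(** Convergence is expressed through the real-valued modulus, the quantity in
    which all error estimates are written. *)
Definition tends u l : Prop :=
  ((fun k => modulus (u k - l)) @ \oo --> (0 : R))%classic.

Lemma squeeze0 (g h : nat -> R) : (forall k, 0 <= g k <= h k) ->
  (h @ \oo --> (0 : R))%classic -> (g @ \oo --> (0 : R))%classic.
Proof.
move=> gh h0; apply: squeeze_cvgr (cvg_cst (0 : R)) h0.
by apply: nearW => k; exact: gh.
Qed.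

Lemma tends_cst c : tends (fun=> c) c.
Proof. by rewrite /tends subrr modulus0; exact: cvg_cst. Qed.

Lemma tends_unique c l : tends (fun=> c) l -> c = l.
Proof.
move=> cl.
apply/eqP; rewrite -subr_eq0 -modulus_eq0; apply/eqP.
exact: (cvg_unique (@Rhausdorff R) (cvg_cst _) cl).
Qed.

Lemma tendsD u v l c : tends u l -> tends v c ->
  tends (fun k => u k + v k) (l + c).
Proof.
move=> ul vc; apply: squeeze0 (_ : (fun k => modulus (u k - l) + modulus (v k - c))
  @ \oo --> (0 : R))%classic => [k|].
  rewrite modulus_ge0 /= (_ : _ - _ = (u k - l) + (v k - c)); last by ring.
  exact: ler_modulusD.
have -> : (0 : R) = 0 + 0 by rewrite addr0.
exact: cvgD.
Qed.

Lemma tendsM u v l c : tends u l -> tends v c ->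
  tends (fun k => u k * v k) (l * c).
Proof.
move=> ul vc.
apply: squeeze0 (_ : (fun k => modulus (u k - l) * modulus (v k - c) +
  modulus l * modulus (v k - c) + modulus (u k - l) * modulus c)
  @ \oo --> (0 : R))%classic => [k|].
  rewrite modulus_ge0 /= -!modulusM.
  rewrite (_ : _ - _ = (u k - l) * (v k - c) + l * (v k - c) + (u k - l) * c).
    by apply: le_trans (ler_modulusD _ _) _; rewrite lerD2r ler_modulusD.
  by ring.
have -> : (0 : R) = 0 * 0 + modulus l * 0 + 0 * modulus c by ring.
by apply: cvgD; [apply: cvgD|]; apply: cvgM => //; exact: cvg_cst.
Qed.

Lemma tends_sum (I : finType) (P : pred I) (u : I -> nat -> R[i]) (l : I -> R[i]) :
  (forall i, tends (u i) (l i)) ->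
  tends (fun k => \sum_(i | P i) u i k) (\sum_(i | P i) l i).
Proof.
move=> ul; rewrite /index_enum; elim: (locked_with _ _) => [|i s IH].
  under [fun k => _]funext => k do rewrite big_nil.
  by rewrite big_nil; exact: tends_cst.
under [fun k => _]funext => k do rewrite big_cons.
by rewrite big_cons; case: (P i) => //; apply: tendsD.
Qed.

Lemma tends_prod (I : finType) (P : pred I) (u : I -> nat -> R[i]) (l : I -> R[i]) :
  (forall i, tends (u i) (l i)) ->
  tends (fun k => \prod_(i | P i) u i k) (\prod_(i | P i) l i).
Proof.
move=> ul; rewrite /index_enum; elim: (locked_with _ _) => [|i s IH].
  under [fun k => _]funext => k do rewrite big_nil.
  by rewrite big_nil; exact: tends_cst.
under [fun k => _]funext => k do rewrite big_cons.
by rewrite big_cons; case: (P i) => //; apply: tendsM.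
Qed.

Lemma cvg_geometric_scale (M r : R) : 0 <= r -> r < 1 ->
  ((fun k => M * r ^+ k) @ \oo --> (0 : R))%classic.
Proof.
move=> r0 r1; have -> : (0 : R) = M * 0 by rewrite mulr0.
apply: cvgM; first exact: cvg_cst.
by apply: cvg_expr; rewrite ger0_norm.
Qed.

Lemma real_geometric_cvg (x : nat -> R) (M r : R) : 0 <= r -> r < 1 ->
  (forall k, `|x k.+1 - x k| <= M * r ^+ k) ->
  exists y : R, (x @ \oo --> y)%classic.
Proof.
move=> r0 r1 xM.
have M0 : 0 <= M by have := le_trans (normr_ge0 _) (xM 0%N); rewrite expr0 mulr1.
have cs : cvgn (series (telescope x)).
  apply: (@normed_cvg R R).
  apply: series_le_cvg (is_cvg_geometric_series (a := M) (z := r) _).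
  - by move=> k; exact: normr_ge0.
  - by move=> k; rewrite /geometric /= mulr_ge0// exprn_ge0.
  - by move=> k; exact: xM.
  - by rewrite ger0_norm.
rewrite telescopeK in cs.
have xE : (fun k => (x k - x 0%N) + x 0%N) = x.
  by apply/funext => k; rewrite subrK.
exists (limn (fun k => x k - x 0%N) + x 0%N); rewrite -[X in (X @ _)%classic]xE.
by apply: cvgD; [exact: cs|exact: cvg_cst].
Qed.

Lemma modulus_le_ReIm (x : R[i]) : modulus x <= `|complex.Re x| + `|complex.Im x|.
Proof.
case: x => s t; rewrite /modulus /=.
have nn : 0 <= `|s| + `|t| by rewrite addr_ge0.
rewrite -(ger0_norm nn) -sqrtr_sqr ler_sqrt ?sqr_ge0// sqrrD.
by rewrite !real_normK ?num_real// addrAC lerDl mulrn_wge0// mulr_ge0.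
Qed.

Lemma Re_le_modulus (x : R[i]) : `|complex.Re x| <= modulus x.
Proof.
case: x => s t; rewrite /modulus /= -sqrtr_sqr ler_sqrt ?addr_ge0 ?sqr_ge0//.
by rewrite lerDl sqr_ge0.
Qed.

Lemma Im_le_modulus (x : R[i]) : `|complex.Im x| <= modulus x.
Proof.
case: x => s t; rewrite /modulus /= -sqrtr_sqr ler_sqrt ?addr_ge0 ?sqr_ge0//.
by rewrite lerDr sqr_ge0.
Qed.

Lemma geometric_tends u (M r : R) : 0 <= r -> r < 1 ->
  (forall k, modulus (u k.+1 - u k) <= M * r ^+ k) -> exists l, tends u l.
Proof.
move=> r0 r1 uM.
have [s us] : exists s : R, ((fun k => complex.Re (u k)) @ \oo --> s)%classic.
  apply: (real_geometric_cvg r0 r1) => k; apply: le_trans (uM k).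
  by apply: le_trans (Re_le_modulus _); rewrite raddfB.
have [t ut] : exists t : R, ((fun k => complex.Im (u k)) @ \oo --> t)%classic.
  apply: (real_geometric_cvg r0 r1) => k; apply: le_trans (uM k).
  by apply: le_trans (Im_le_modulus _); rewrite raddfB.
exists (s +i* t)%C.
apply: squeeze0 (_ : (fun k => `|complex.Re (u k) - s| +
  `|complex.Im (u k) - t|) @ \oo --> (0 : R))%classic.
  by move=> k; rewrite modulus_ge0 (le_trans (modulus_le_ReIm _))// !raddfB.
have -> : (0 : R) = 0 + 0 by rewrite addr0.
apply: cvgD.
  have -> : (0 : R) = `|s - s| by rewrite subrr normr0.
  by apply: cvg_norm; apply: cvgB => //; exact: cvg_cst.
have -> : (0 : R) = `|t - t| by rewrite subrr normr0.
by apply: cvg_norm; apply: cvgB => //; exact: cvg_cst.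
Qed.

Lemma modulus_geometric_le u (M r : R) k : 0 <= r -> r < 1 ->
  (forall k, modulus (u k.+1 - u k) <= M * r ^+ k) ->
  modulus (u k - u 0%N) <= M / (1 - r).
Proof.
move=> r0 r1 uM.
have M0 : 0 <= M by have := le_trans (modulus_ge0 _) (uM 0%N); rewrite expr0 mulr1.
have q0 : 0 < 1 - r by rewrite subr_gt0.
apply: le_trans (_ : M * (1 - r ^+ k) / (1 - r) <= _); last first.
  by rewrite ler_wpM2r ?invr_ge0 ?(ltW q0)// ler_piMr// gerBl exprn_ge0.
elim: k => [|k IH]; first by rewrite expr0 !subrr modulus0 mulr0 mul0r.
have -> : u k.+1 - u 0%N = (u k.+1 - u k) + (u k - u 0%N) by ring.
apply: le_trans (ler_modulusD _ _) _; apply: le_trans (lerD (uM k) IH) _.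
rewrite le_eqVlt; apply/orP; left; apply/eqP.
by rewrite exprS; field; rewrite gt_eqF.
Qed.

Lemma tends_geometric_le u l (M r : R) : 0 <= r -> r < 1 ->
  (forall k, modulus (u k.+1 - u k) <= M * r ^+ k) -> tends u l ->
  modulus (u 0%N - l) <= M / (1 - r).
Proof.
move=> r0 r1 uM ul; apply/ler_addgt0Pr => e e0.
have /cvgrPdist_le/(_ e e0)[N _ /(_ N (leqnn N)) /=] := ul.
rewrite sub0r normrN ger0_norm ?modulus_ge0// => uN.
have -> : u 0%N - l = (u N - l) - (u N - u 0%N) by ring.
rewrite addrC; apply: le_trans (ler_modulusD _ _) _; rewrite modulusN.
exact: (lerD (modulus_geometric_le N r0 r1 uM) uN).
Qed.

End ComplexLimits.

(** * The limit is a root-vector *)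

Section NoureinLimit.
Variables (R : realType) (n : nat) (f : {poly R[i]}) (p q : \bar R).
Hypothesis n_ge2 : (2 <= n)%N.
Hypotheses (f_monic : f \is monic) (f_deg : size f = n.+1).
Hypotheses (p_ge1 : (1 <= p)%E) (pq_conj : (p^-1 + q^-1 = 1)%E).

Local Notation phi := (Defs.phi n q).
Local Notation psi := (Defs.psi n q).
Local Notation mu := (Defs.mu n q).
Local Notation E := (@initialE R n p f).
Local Notation W := (@weierstrass R n f).
Local Notation good_start := (@good_start R n f p q).

Let coefs := coef_bounds n_ge2 p_ge1 pq_conj.

Definition limit_of (z0 xi : 'rV[R[i]]_n) : Prop :=
  forall i, tends (fun k => nourein_seq f z0 k 0 i) (xi 0 i).

(** The sum of the geometric series of the increments, relative to the first
    Weierstrass correction. *)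
Definition error_factor (x : R) : R := mu x / (1 - psi x * phi x).

Lemma nourein_limit z0 : good_start z0 -> exists xi, limit_of z0 xi.
Proof.
move=> g0; have /choice[l lP] : forall i, exists c,
    tends (fun k => nourein_seq f z0 k 0 i) c.
  move=> i; apply: geometric_tends (rate_ge0 n_ge2 p_ge1 pq_conj g0)
    (rate_lt1 n_ge2 p_ge1 pq_conj g0) _ => k.
  exact: (nourein_seq_increment_le n_ge2 f_monic f_deg p_ge1 pq_conj g0).
by exists (\row_i l i) => i; rewrite mxE.
Qed.

Lemma limit_error_le0 z0 xi i : good_start z0 -> limit_of z0 xi ->
  modulus (z0 0 i - xi 0 i) <= error_factor (E z0) * modulus (W z0 0 i).
Proof.
move=> g0 lim; rewrite /error_factor mulrAC.
apply: (tends_geometric_le (rate_ge0 n_ge2 p_ge1 pq_conj g0)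
    (rate_lt1 n_ge2 p_ge1 pq_conj g0) _ (lim i)) => k.
exact: (nourein_seq_increment_le n_ge2 f_monic f_deg p_ge1 pq_conj g0).
Qed.

Lemma limit_of_shift z0 xi k : limit_of z0 xi -> limit_of (nourein_seq f z0 k) xi.
Proof.
move=> lim i; rewrite /tends.
under [X in (X @ _)%classic]funext => j do rewrite -nourein_seqD.
have := lim i; rewrite /tends => /(cvg_comp _ _ (cvg_addnr k)).
exact.
Qed.

Variables z0 xi : 'rV[R[i]]_n.
Hypotheses (z0_good : good_start z0) (xi_lim : limit_of z0 xi).

Local Notation z := (nourein_seq f z0).
Local Notation lam := (phi (E z0)).
Local Notation theta := (psi (E z0)).

Let good k : good_start (z k).
Proof. exact: good_start_iter. Qed.

(** The a posteriori estimate, componentwise: restart the iteration at z^k. *)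
Lemma limit_error_le k i :
  modulus (z k 0 i - xi 0 i) <= error_factor (E (z k)) * modulus (W (z k) 0 i).
Proof. by apply: limit_error_le0 => //; exact: limit_of_shift. Qed.

Lemma error_factor_ge0 x : 0 <= x -> x < gauge_radius n q -> phi x <= 1 ->
  0 <= error_factor x.
Proof.
move=> x0 xr x1; apply: divr_ge0.
  exact: le_trans ler01 (mu_ge1 coefs x0 xr).
by rewrite subr_ge0 ltW// (psi_phi_lt1 coefs).
Qed.

Lemma error_factor_le x y s t : 0 <= y -> y <= x -> x < gauge_radius n q ->
  psi y * phi y <= t -> t < 1 -> mu x = s -> error_factor y <= s / (1 - t).
Proof.
move=> y0 yx xr yt t1 <-.
apply: ler_pM; last 2 first.
- exact: (mu_mono coefs).
- by rewrite lef_pV2 ?posrE ?subr_gt0 ?(le_lt_trans yt)// lerD2l lerN2.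
- exact: le_trans ler01 (mu_ge1 coefs y0 (le_lt_trans yx xr)).
- by rewrite invr_ge0 subr_ge0 ltW// (le_lt_trans yt).
Qed.

Let E0 : 0 <= E z0. Proof. exact: initialE_ge0. Qed.
Let z0r : E z0 < gauge_radius n q. Proof. by case: z0_good. Qed.

Lemma pnorm_limit_error_le k : pnorm p (z k - xi) <=
  error_factor (E (z k)) * pnorm p (W (z k)).
Proof.
apply: pnorm_le => // [|i]; last first.
  have -> : (z k - xi) 0 i = z k 0 i - xi 0 i by rewrite !mxE.
  exact: limit_error_le.
have [_ zr z1] := good k; exact: error_factor_ge0 (initialE_ge0 _ _ _) zr z1.
Qed.

(** Let k tend to infinity in [horner_weierstrass] at z^k: the left-hand side does
    not depend on k and the corrections tend to 0. *)
Lemma limit_factorization x : f.[x] = \prod_j (x - xi 0 j).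
Proof.
have W0 j : tends (fun k => W (z k) 0 j) 0.
  have r0 := rate_ge0 n_ge2 p_ge1 pq_conj z0_good.
  have r1 := rate_lt1 n_ge2 p_ge1 pq_conj z0_good.
  apply: squeeze0 (cvg_geometric_scale (modulus (W z0 0 j)) r0 r1) => k.
  rewrite modulus_ge0 subr0 mulrC /=.
  exact: (nourein_seq_W_geometric n_ge2 f_monic f_deg p_ge1 pq_conj z0_good).
have factor j : tends (fun k => x - z k 0 j) (x - xi 0 j).
  apply: tendsD; first exact: tends_cst.
  have := tendsM (tends_cst (-1)) (xi_lim j); rewrite mulN1r.
  by under [fun k => _]funext => k do rewrite mulN1r.
suff : tends (fun=> f.[x]) (\prod_j (x - xi 0 j) +
    \sum_(j < n) 0 * \prod_(k | k != j) (x - xi 0 k)).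
  move=> /tends_unique ->; rewrite [X in _ + X]big1 ?addr0// => j _.
  exact: mul0r.
have -> : (fun=> f.[x]) = (fun k => \prod_j (x - z k 0 j) +
    \sum_j W (z k) 0 j * \prod_(l | l != j) (x - z k 0 l)).
  apply/funext => k; have [zi _ _] := good k.
  exact: horner_weierstrass.
apply: tendsD; first exact: (@tends_prod _ _ _ (fun j k => x - z k 0 j)).
apply: (@tends_sum _ _ _ (fun j k =>
  W (z k) 0 j * \prod_(l | l != j) (x - z k 0 l))) => j.
by apply: tendsM => //; exact: (@tends_prod _ _ _ (fun j k => x - z k 0 j)).
Qed.

Lemma limit_root_vector : root_vector f xi.
Proof.
have fE : f = \prod_(j <- [seq xi 0 i | i <- enum 'I_n]) ('X - j%:P).
  rewrite big_map big_enum /=; set g := \prod_(i < n) _.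
  apply/eqP; rewrite -subr_eq0; apply/negP => /negP ne0.
  set h := f - g in ne0.
  (* A nonzero h would have the roots 0, 1, ..., size h - 1, one too many. *)
  have := max_poly_roots (rs := [seq (i%:R : R[i]) | i <- iota 0 (size h)]) ne0.
  rewrite size_map size_iota ltnn map_inj_uniq ?iota_uniq; last first.
    by move=> i j /eqP; rewrite eqr_nat => /eqP.
  move=> H; suff: false by []; apply: H => //; apply/allP => _ /mapP[i _ ->].
  rewrite /root /h hornerD hornerN limit_factorization /g horner_prod subr_eq0.
  by apply/eqP; apply: eq_bigr => j _; rewrite hornerXsubC.
move=> x; rewrite fE mu_prod_XsubC count_map enumT.
rewrite cardE [in RHS]/enum_mem size_filter.
by apply: eq_count => i; rewrite !inE.
Qed.

Let K1 := error_factor (E z0).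

Let r1 : theta * lam < 1. Proof. exact: rate_lt1 z0_good. Qed.

Let error_factor_le0 k : error_factor (E (z k)) <= K1.
Proof.
apply: error_factor_le z0r _ r1 erefl; first exact: initialE_ge0.
  exact: (nourein_seq_E_le0 n_ge2 f_monic f_deg p_ge1 pq_conj z0_good).
exact: (nourein_seq_rate_le0 n_ge2 f_monic f_deg p_ge1 pq_conj z0_good).
Qed.

Let K1_ge0 : 0 <= K1.
Proof. by have [_ zr z1] := z0_good; exact: error_factor_ge0. Qed.

Lemma nourein_converges : converges_to p z xi.
Proof.
have r0 := rate_ge0 n_ge2 p_ge1 pq_conj z0_good.
apply: squeeze0 (cvg_geometric_scale (K1 * pnorm p (W z0)) r0 r1) => k.
rewrite pnorm_ge0/=; apply: le_trans (pnorm_limit_error_le k) _.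
rewrite -[leRHS]mulrA; apply: ler_pM; rewrite ?pnorm_ge0//.
- have [_ zr z1] := good k; exact: error_factor_ge0 (initialE_ge0 _ _ _) zr z1.
- rewrite mulrC; apply: pnorm_le => //; first exact: exprn_ge0.
  exact: (nourein_seq_W_geometric n_ge2 f_monic f_deg p_ge1 pq_conj z0_good).
Qed.

(** * Order of convergence *)

(** The total displacement is at most K1 |W_i|, so distances lose at most the
    relative amount b E(z^0) K1 = (1 - theta) / (1 - theta lam). When lam < 1 this
    stays below 1, and the components remain apart uniformly in k. *)
Lemma nourein_seq_distance_ge k i j :
  theta * (1 - lam) / (1 - theta * lam) * modulus (z0 0 i - z0 0 j) <=
  modulus (z k 0 i - z k 0 j).
Proof.
have [->|ji] := eqVneq j i; first by rewrite !subrr modulus0 mulr0.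
have r0 := rate_ge0 n_ge2 p_ge1 pq_conj z0_good.
have move_le l : modulus (z k 0 l - z0 0 l) <= K1 * modulus (W z0 0 l).
  rewrite /K1 /error_factor mulrAC.
  apply: (@modulus_geometric_le _ (fun k => z k 0 l) _ _ k r0 r1) => k'.
  exact: (nourein_seq_increment_le n_ge2 f_monic f_deg p_ge1 pq_conj z0_good).
have [zi zr _] := z0_good.
have pair := weierstrass_pair_le f n_ge2 p_ge1 pq_conj zi ji.
have H := ler_wpM2l K1_ge0 pair.
have -> : z k 0 i - z k 0 j =
  (z0 0 i - z0 0 j) - ((z k 0 j - z0 0 j) - (z k 0 i - z0 0 i)) by ring.
apply: le_trans (ler_modulusB _ _).
have H1 := ler_modulusD (z k 0 j - z0 0 j) (- (z k 0 i - z0 0 i)).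
rewrite modulusN in H1.
have Hi := move_le i; have Hj := move_le j.
have -> : theta * (1 - lam) / (1 - theta * lam) =
    1 - K1 * (coef_b q * E z0).
  have r1' : 1 - theta * lam != 0 by rewrite subr_eq0 eq_sym lt_eqF.
  have -> : coef_b q * E z0 = (1 - theta) / mu (E z0).
    rewrite (psiE coefs E0 z0r); field.
    by rewrite gt_eqF// (lt_le_trans ltr01)// (mu_ge1 coefs).
  rewrite /K1 /error_factor; field; rewrite r1' gt_eqF//.
  by rewrite (lt_le_trans ltr01)// (mu_ge1 coefs).
lra.
Qed.

(** The factorisation of f at the limit writes W_i(z) as z_i - xi_i times the
    product of the ratios (z_i - xi_j) / (z_i - z_j), which are bounded since
    |z_j - xi_j| <= K1 |W_j|. *)
Lemma weierstrass_le_error k i : modulus (W (z k) 0 i) <=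
  (1 + K1 * E z0) ^+ (n - 1) * modulus ((z k - xi) 0 i).
Proof.
have [zi zr _] := good k.
have -> : (z k - xi) 0 i = z k 0 i - xi 0 i by rewrite !mxE.
have -> : W (z k) 0 i = (z k 0 i - xi 0 i) *
    \prod_(j | j != i) ((z k 0 i - xi 0 j) / (z k 0 i - z k 0 j)).
  rewrite mxE limit_factorization (bigD1 i)//= prodf_div.
  by rewrite -[LHS]mulrA.
rewrite modulusM mulrC ler_wpM2r ?modulus_ge0// modulus_prod.
have card : #|predC1 i| = (n - 1)%N by rewrite cardC1 card_ord subn1.
rewrite -card -prodr_const; apply: ler_prod => j ji; rewrite modulus_ge0 /=.
have D : 0 < modulus (z k 0 i - z k 0 j) by rewrite modulus_gt0 neq_components.
rewrite modulusM modulusV ler_pdivrMr// mulrDl mul1r.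
have -> : z k 0 i - xi 0 j = (z k 0 i - z k 0 j) + (z k 0 j - xi 0 j) by ring.
apply: le_trans (ler_modulusD _ _) _; rewrite lerD2l.
apply: le_trans (limit_error_le k j) _; rewrite -[leRHS]mulrA.
apply: ler_pM; rewrite ?modulus_ge0//.
  by have [_ zr' z1] := good k; exact: error_factor_ge0 (initialE_ge0 _ _ _) zr' z1.
apply: le_trans (weierstrass_le_dist f n_ge2 p_ge1 pq_conj zi ji) _.
rewrite ler_wpM2r ?modulus_ge0//.
exact: (nourein_seq_E_le0 n_ge2 f_monic f_deg p_ge1 pq_conj z0_good).
Qed.

(** With E <= S |W| (separation) and psi phi <= B E^3 (scaling), the chain is
    |z^(k+1) - xi| <= K1 |W(z^(k+1))| <= K1 B E(z^k)^3 |W(z^k)|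
    <= K1 B S^3 |W(z^k)|^4 <= K1 B S^3 K^4 |z^k - xi|^4. *)
Lemma nourein_order4 : lam < 1 -> convergence_order p z xi 4.
Proof.
move=> lam1; split; first exact: nourein_converges.
set c := theta * (1 - lam) / (1 - theta * lam).
have c0 : 0 < c.
  apply: divr_gt0; last by rewrite subr_gt0.
  by rewrite mulr_gt0 ?subr_gt0// (theta_gt0 n_ge2 p_ge1 pq_conj z0_good).
(* S majorises every 1 / d_i (z k), uniformly in i and k. *)
set S := \sum_(i < n) (c * separation z0 i)^-1.
have [z0i _ _] := z0_good.
have sep0 i : 0 < c * separation z0 i by rewrite mulr_gt0// separation_gt0.
have S_ge i : (c * separation z0 i)^-1 <= S.
  rewrite /S (bigD1 i)//= lerDl sumr_ge0// => j _.
  by rewrite invr_ge0 ltW.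
have E_le k : E (z k) <= S * pnorm p (W (z k)).
  apply: pnorm_le => // [|i]; first by apply: sumr_ge0 => i _; rewrite invr_ge0 ltW.
  have -> : (\row_i0 (W (z k) 0 i0 / (separation (z k) i0)%:C)) 0 i =
    W (z k) 0 i / (separation (z k) i)%:C by rewrite [LHS]mxE.
  have [zki _ _] := good k.
  have sk := separation_gt0 n_ge2 i zki.
  rewrite modulusM modulusV modulus_real ?(ltW sk)// mulrC ler_wpM2r ?modulus_ge0//.
  apply: le_trans (S_ge i); rewrite lef_pV2 ?posrE//.
  apply: separation_ge => // j ji; apply: le_trans (nourein_seq_distance_ge k i j).
  by rewrite ler_wpM2l ?(ltW c0)// separation_le.
(* If E z0 = 0, then B = 0 and E (z k) = 0, so the bound below still holds. *)
set B := theta * lam / E z0 ^+ 3.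
have rate_le k : psi (E (z k)) * phi (E (z k)) <= B * E (z k) ^+ 3.
  have Ek0 := initialE_ge0 f p (z k).
  have Ek := nourein_seq_E_le0 n_ge2 f_monic f_deg p_ge1 pq_conj z0_good k.
  rewrite /B (_ : theta * lam / E z0 ^+ 3 * E (z k) ^+ 3 =
     (E (z k) / E z0) ^+ 3 * (theta * lam)); last by rewrite expr_div_n; ring.
  apply: psi_phi_scale => //.
    rewrite divr_ge0//=; move: E0; rewrite le_eqVlt => /predU1P[<-|E0'].
      by rewrite invr0 mulr0.
    by rewrite ler_pdivrMr// mul1r.
  move: E0 Ek; rewrite le_eqVlt => /predU1P[<-|E0' _]; first by rewrite mulr0.
  by rewrite divfK// gt_eqF.
set K := (1 + K1 * E z0) ^+ (n - 1).
have K0 : 0 <= K by rewrite exprn_ge0// addr_ge0// mulr_ge0.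
have W_le k : pnorm p (W (z k)) <= K * pnorm p (z k - xi).
  by apply: pnorm_le => // i; exact: weierstrass_le_error.
have B0 : 0 <= B.
  by rewrite divr_ge0 ?exprn_ge0// (rate_ge0 n_ge2 p_ge1 pq_conj z0_good).
have S0 : 0 <= S by apply: sumr_ge0 => i _; rewrite invr_ge0 ltW.
exists (K1 * (B * S ^+ 3 * K ^+ 4)); apply: nearW => k.
have e0 := pnorm_ge0 p (z k - xi); have w0 := pnorm_ge0 p (W (z k)).
apply: le_trans (pnorm_limit_error_le k.+1) _.
rewrite -[leRHS]mulrA; apply: ler_pM; rewrite ?pnorm_ge0//.
  have [_ zr' z1] := good k.+1.
  exact: error_factor_ge0 (initialE_ge0 _ _ _) zr' z1.
apply: le_trans (_ : psi (E (z k)) * phi (E (z k)) * pnorm p (W (z k)) <= _).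
  have [_ zr _] := good k; have Ek0 := initialE_ge0 f p (z k).
  apply: pnorm_le => // [|i].
    by apply: mulr_ge0; [exact: (ltW (psi_gt0 coefs Ek0 zr))|exact: (phi_ge0 coefs)].
  exact: (nourein_seq_W_step n_ge2 f_monic f_deg p_ge1 pq_conj z0_good).
apply: le_trans (ler_wpM2r w0 (rate_le k)) _.
apply: le_trans (_ : B * (S * pnorm p (W (z k))) ^+ 3 * pnorm p (W (z k)) <= _).
  apply: ler_wpM2r => //; apply: ler_wpM2l => //.
  by apply: lerXn2r; rewrite ?nnegrE ?initialE_ge0 ?E_le ?mulr_ge0.
rewrite (_ : B * _ * _ = B * S ^+ 3 * pnorm p (W (z k)) ^+ 4); last by ring.
rewrite -[leRHS]mulrA -exprMn; apply: ler_wpM2l.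
  by rewrite mulr_ge0 ?exprn_ge0.
by apply: lerXn2r; rewrite ?nnegrE ?W_le ?mulr_ge0.
Qed.

End NoureinLimit.

(** * The convergence theorem *)

Theorem theorem4p1 (R : realType) (n : nat) (hn : (2 <= n)%N)
  (f : {poly R[i]}) (f_monic : f \is monic) (f_deg : size f = n.+1)
  (p q : \bar R) (hp : (1 <= p)%E) (hpq : (p^-1 + q^-1 = 1)%E)
  (z0 : 'rV[R[i]]_n) (hz0 : distinct_components z0)
  (hE : initialE p f z0 <
        2 / (coef_m n q + Num.sqrt (coef_m n q ^+ 2 - 4 * coef_b q)))
  (hphi : phi n q (initialE p f z0) <= 1) :
  let z := nourein_seq f z0 in
  let E := initialE p f in
  (forall k : nat, nourein_domain f (z k)) /\
  exists xi : 'rV[R[i]]_n,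
    [/\ root_vector f xi,
        converges_to p z xi,
        phi n q (E z0) < 1 -> convergence_order p z xi 4,
        forall k : nat, (1 <= k)%N ->
          let lam := phi n q (E z0) in
          let theta := psi n q (E z0) in
          pnorm p (z k - xi) <=
            mu n q (E z0 * lam ^+ ((4 ^ k - 1) %/ 3)) *
            (theta ^+ k * lam ^+ ((4 ^ k - 1) %/ 3) /
             (1 - theta * lam ^+ (4 ^ k))) *
            pnorm p (weierstrass f z0)
      & forall k : nat,
          let lamk := phi n q (E (z k)) in
          let thetak := psi n q (E (z k)) in
          pnorm p (z k - xi) <=
            mu n q (E (z k)) / (1 - thetak * lamk) *
            pnorm p (weierstrass f (z k))].
Proof.
move=> z E.
have coefs := coef_bounds hn hp hpq.
have good0 : good_start f p q z0 by [].
have good k : good_start f p q (z k) by exact: good_start_iter.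
have E0 k : 0 <= E (z k) by exact: initialE_ge0.
split.
  move=> k; have [zi zr _] := good k.
  exact: (nourein_domain_below_radius hn hp hpq zi zr).
have [xi lim] := nourein_limit hn f_monic f_deg hp hpq good0.
exists xi; split.
- exact: (limit_root_vector hn f_monic f_deg hp hpq good0 lim).
- exact: (nourein_converges hn f_monic f_deg hp hpq good0 lim).
- exact: (nourein_order4 hn f_monic f_deg hp hpq good0 lim).
- move=> k _; cbv zeta.
  set lam := phi n q (E z0); set theta := psi n q (E z0).
  set e := ((4 ^ k - 1) %/ 3)%N.
  have lam0 : 0 <= lam := lam_ge0 hn hp hpq good0.
  have lam1 : lam <= 1 := lam_le1 good0.
  have th0 : 0 < theta := theta_gt0 hn hp hpq good0.
  have r1 : theta * lam < 1 := rate_lt1 hn hp hpq good0.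
  have [_ zr _] := good0.
  have x0 : 0 <= E z0 * lam ^+ e by rewrite mulr_ge0 ?exprn_ge0// (E0 0%N).
  have xr : E z0 * lam ^+ e < gauge_radius n q.
    by apply: le_lt_trans zr; rewrite ler_piMr ?(E0 0%N)// exprn_ile1.
  have rk1 : theta * lam ^+ (4 ^ k) < 1.
    apply: le_lt_trans r1; rewrite ler_wpM2l ?(ltW th0)//.
    by rewrite -(prednK (_ : 0 < 4 ^ k)%N) ?expn_gt0// exprS ler_piMr// exprn_ile1.
  apply: le_trans (pnorm_limit_error_le hn f_monic f_deg hp hpq good0 lim k) _.
  rewrite (_ : _ * _ * _ = mu n q (E z0 * lam ^+ e) / (1 - theta * lam ^+ (4 ^ k)) *
    (theta ^+ k * lam ^+ e * pnorm p (weierstrass f z0))); last by ring.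
  apply: ler_pM; rewrite ?pnorm_ge0//.
  + have [_ zkr zk1] := good k.
    exact: (error_factor_ge0 hn hp hpq (E0 k) zkr zk1).
  + apply: (error_factor_le hn hp hpq (E0 k) _ xr) rk1 erefl.
      by rewrite mulrC; exact: (nourein_seq_E_le hn f_monic f_deg hp hpq good0).
    exact: (nourein_seq_rate_le hn f_monic f_deg hp hpq good0).
  + apply: pnorm_le => // [|i].
      by rewrite mulr_ge0 ?exprn_ge0// ltW.
    exact: (nourein_seq_W_le hn f_monic f_deg hp hpq good0).
- move=> k; cbv zeta.
  exact: (pnorm_limit_error_le hn f_monic f_deg hp hpq good0 lim).
Qed.
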